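(* The algorithm AugmentedGreedy is an $m$-approximation algorithm for the (directed or undirected) decoupled freeform spanner problem: for every instance $(G=(V,E),K,w,\ell,\delta)$ of the problem, directed or undirected, with $m=|E|$ edges, that admits a feasible spanner, AugmentedGreedy runs in polynomial time and returns a feasible spanner $H$ with $w(H)\le m\cdot \mathrm{OPT}$, where $\mathrm{OPT}$ is the minimum weight of a feasible spanner of the instance.
   Context: Decoupled freeform spanner problem. An instance consists of a connected, simple, directed or undirected graph $G=(V,E)$ with $n$ nodes and $m\ge 1$ edges, terminal pairs $K\subseteq V\times V$ (unordered pairs in the undirected case), weights $w\colon E\to\mathbb{Q}_{\ge 0}$, lengths $\ell\colon E\to\mathbb{Q}_{>0}$ (weights and lengths are independent of each other), and distance demands $\delta\colon K\to\mathbb{Q}_{>0}$. For a graph $G'$, $d^\ell_{G'}(u,v)$ is the length w.r.t. $\ell$ of a shortest path from $u$ to $v$ in $G'$ ($\infty$ if none exists). A feasible spanner is a subgraph $H=(V,E')$, $E'\subseteq E$, with $d_H^\ell(u,v)\le\delta(u,v)$ for all $(u,v)\in K$. The goal is to minimize $w(H):=\sum_{e\in E'}w(e)$. Greedy$(G,K,\ell,\delta)$: start with $H=(V,\emptyset)$; process the pairs $(u,v)\in K$ in non-decreasing order of $d_G^\ell(u,v)$; if $d_H^\ell(u,v)>\delta(u,v)$ for the current $H$, add to $H$ (all edges of) the shortest $uv$-path of $G$ w.r.t. $\ell$, where ties are broken consistently so that shortest paths are unique (e.g. by a suitable perturbation of lengths or lexicographically). Return $H$. AugmentedGreedy$(G,K,w,\ell,\delta)$: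 let $\mathcal W=\{w(e):e\in E\}$ and, for a number $w'$, let $G[w']=(V,E[w'])$ with $E[w']=\{e\in E: w(e)\le w'\}$. (1) By binary search over sorted $\mathcal W$ determine $\hat w=\min\{w'\in\mathcal W: G[w']\text{ is a feasible spanner}\}$. (2) Only if the problem variant under consideration guarantees that every feasible spanner is an undirected connected graph spanning all nodes (so that the weight of a minimum-weight spanning tree $\mathit{MST}(G,w)$ is a lower bound on the optimum): set $\hat w\leftarrow\max\{\hat w, w(\mathit{MST}(G,w))\}$. (3) Return Greedy$(G[\hat w],K,\ell,\delta)$. *)

(* Defs.v *)
From HB Require Import structures.
From mathcomp Require Import all_boot all_order all_algebra.
From mathcomp Require Import constructive_ereal.

Set Implicit Arguments.
Unset Strict Implicit.
Unset Printing Implicit Defensive.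

Import Order.TTheory GRing.Theory Num.Theory.

Local Open Scope ring_scope.

(** * Graphs *)

(* The nodes are 'I_nV, the edges are 'I_nE; subgraphs (V, F) of a graph are
   given by their edge sets F : {set 'I_nE}. *)
Record graph := Graph {
  directed : bool;
  nV : nat;
  nE : nat;
  ends : 'I_nE -> 'I_nV * 'I_nV
}.

Notation node G := ('I_(nV G)).
Notation edge G := ('I_(nE G)).

Section Graphs.
Variable G : graph.
Implicit Types (F T : {set edge G}) (e : edge G) (x y u v : node G).

(* Equality of node pairs: ordered if G is directed, unordered otherwise. *)
Definition same_pair (a b : node G * node G) : bool :=
  (a == b) || ~~ directed G && (a == (b.2, b.1)).

Definition joins e x y : bool := same_pair (ends e) (x, y).

(* Antiparallel arcs are allowed in a directed graph. *)
Definition simple_graph : Prop :=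
  (forall e, (ends e).1 != (ends e).2) /\
  (forall e f, same_pair (ends e) (ends f) -> e = f).

(* Orientations are disregarded: for a directed graph this is weak
   connectedness. *)
Definition adjacent F : rel (node G) :=
  fun x y => [exists e in F, joins e x y || joins e y x].

Definition connected F : bool := [forall x, forall y, connect (adjacent F) x y].

(* There is a cycle through an edge of T iff the ends of that edge are still
   connected once the edge is removed. *)
Definition acyclic T : bool :=
  [forall e in T, ~~ connect (adjacent (T :\ e)) (ends e).1 (ends e).2].

Definition spanning_tree T : bool := connected T && acyclic T.

(* A step (e, y) traverses the edge e and arrives at the node y. *)
Fixpoint is_walk F u (p : seq (edge G * node G)) v : bool :=
  if p is (e, y) :: p' then [&& e \in F, joins e u y & is_walk F y p' v]
  else u == v.

Definition is_path F u (p : seq (edge G * node G)) v : bool :=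
  is_walk F u p v && uniq (u :: unzip2 p).

(* Paths visit each node at most once, so this finite type holds all of them. *)
Definition steps := {bseq nV G of edge G * node G}.

Definition path_edges (p : steps) : {set edge G} := [set e in unzip1 p].

Definition path_length (len : edge G -> rat) (p : steps) : rat :=
  \sum_(s <- p) len s.1.

(* d_(V,F)(u, v), with value +oo if there is no path *)
Definition dist (len : edge G -> rat) F u v : \bar rat :=
  \big[Order.min/+oo%E]_(p : steps | is_path F u p v) (path_length len p)%:E.

(* Consistent tie-breaking by perturbation: the order in which p is not longer
   than q once the length of the i-th edge is increased by 2 ^ i * eps, for an
   infinitesimal eps > 0. Distinct edge sets get distinct perturbations. *)
Definition perturbation (p : steps) : nat := (\sum_(s <- p) 2 ^ s.1)%N.

Definition not_longer (len : edge G -> rat) (p q : steps) : bool :=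
  (path_length len p < path_length len q) ||
  (path_length len p == path_length len q) &&
  (perturbation p <= perturbation q)%N.

Definition shortest_path (len : edge G -> rat) F u v : option steps :=
  [pick p : steps | is_path F u p v &
     [forall q : steps, is_path F u q v ==> not_longer len p q]].

End Graphs.

(** * Instances of the decoupled freeform spanner problem *)

Record instance := Instance {
  G :> graph;
  nK : nat;
  terminals : 'I_nK -> node G * node G;
  weight : edge G -> rat;
  len : edge G -> rat;
  demand : 'I_nK -> rat;
  simpleG : simple_graph G;
  connectedG : connected [set: edge G];
  edges_gt0 : (0 < nE G)%N;
  terminals_uniq : forall i j, same_pair (terminals i) (terminals j) -> i = j;
  weight_ge0 : forall e, 0 <= weight e;
  len_gt0 : forall e, 0 < len e;
  demand_gt0 : forall i, 0 < demand i
}.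

Section Spanners.
Variable I : instance.
Implicit Types F H : {set edge I}.

Definition tdist F (i : 'I_(nK I)) : \bar rat :=
  dist (@len I) F (terminals i).1 (terminals i).2.

Definition feasible F : bool := [forall i, (tdist F i <= (demand i)%:E)%E].

Definition total_weight F : rat := \sum_(e in F) weight e.

(* As weights are nonnegative and feasibility is monotone, the default value is
   not below the minimum whenever there is a feasible spanner. *)
Definition OPT : rat :=
  \big[Order.min/total_weight [set: edge I]]_(F : {set edge I} | feasible F)
    total_weight F.

(* Likewise for the spanning trees of an undirected G. *)
Definition MST_weight : rat :=
  \big[Order.min/total_weight [set: edge I]]_(T : {set edge I} | spanning_tree T)
    total_weight T.

(** * The algorithms *)

(* Greedy on the subgraph (V, F) of G *)
Definition greedy F : {set edge I} :=
  let add_pair H i :=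
    if (tdist H i <= (demand i)%:E)%E then H
    else if shortest_path (@len I) F (terminals i).1 (terminals i).2 is Some p
         then H :|: path_edges p
         else H in
  foldl add_pair set0
    (sort (fun i j => (tdist F i <= tdist F j)%E) (enum 'I_(nK I))).

Definition sorted_weights : seq rat :=
  sort <=%R (undup [seq weight e | e <- enum (edge I)]).

Definition light_edges (w : rat) : {set edge I} := [set e | weight e <= w].

(* Least index in [lo, hi] satisfying the monotone test P, provided that P hi
   holds and fuel >= hi - lo *)
Fixpoint binary_search (P : pred nat) (fuel lo hi : nat) : nat :=
  if fuel is fuel'.+1 then
    if (hi <= lo)%N then lo
    else let mid := (lo + hi)./2 in
         if P mid then binary_search P fuel' lo mid
         else binary_search P fuel' mid.+1 hi
  else lo.

Definition threshold : rat :=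
  let W := sorted_weights in
  W`_(binary_search (fun i => feasible (light_edges W`_i))
        (size W) 0 (size W).-1).

(* mst tells whether the optional MST step is part of the algorithm. *)
Definition augmented_greedy (mst : bool) : {set edge I} :=
  greedy (light_edges
    (if mst then Num.max threshold MST_weight else threshold)).

End Spanners.

(* A problem variant is a class of instances. *)
Definition guarantees_connected (variant : instance -> Prop) : Prop :=
  forall I : instance, variant I ->
    ~~ directed I /\ forall F : {set edge I}, feasible F -> connected F.

(** * Polynomial time *)

(* A first-order language on binary trees with natural numbers at the leaves
   and variables in de Bruijn style. Lists are right combs ending in a leaf;
   [Fold l a b] is a left fold of the list l from a, whose body b sees the
   current element as variable 0 and the accumulator as variable 1. *)
Inductive data := Nat of nat | Pair of data & data.

Inductive op := Add | Sub | Mul | Div | Leq.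

Inductive exp :=
| Var of nat
| Cst of nat
| MkPair of exp & exp
| Fst of exp
| Snd of exp
| IsNat of exp
| Op of op & exp & exp
| If of exp & exp & exp
| Let of exp & exp
| Fold of exp & exp & exp.

Definition natval (d : data) : nat := if d is Nat n then n else 0%N.

Definition eval_op (o : op) (m n : nat) : nat :=
  match o with
  | Add => (m + n)%N
  | Sub => (m - n)%N
  | Mul => (m * n)%N
  | Div => (m %/ n)%N
  | Leq => nat_of_bool (m <= n)%N
  end.

(* Number of binary digits *)
Definition bits (n : nat) : nat := (trunc_log 2 n).+1.

Fixpoint fold_data (f : data -> data -> data * nat) (l acc : data) : data * nat :=
  if l is Pair x l' then
    let r := f x acc in
    let r' := fold_data f l' r.1 in (r'.1, (r.2 + r'.2).+1)
  else (acc, 0%N).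

(* Value and running time. Every construct costs one step, except that
   arithmetic is charged as by the schoolbook methods on binary numbers. Trees
   are passed by reference, whence the unit cost of Var and MkPair. *)
Fixpoint eval (s : seq data) (e : exp) : data * nat :=
  match e with
  | Var i => (nth (Nat 0) s i, 1%N)
  | Cst n => (Nat n, 1%N)
  | MkPair a b =>
      let ra := eval s a in let rb := eval s b in
      (Pair ra.1 rb.1, (ra.2 + rb.2).+1)
  | Fst a =>
      let r := eval s a in (if r.1 is Pair x _ then x else Nat 0, r.2.+1)
  | Snd a =>
      let r := eval s a in (if r.1 is Pair _ y then y else Nat 0, r.2.+1)
  | IsNat a =>
      let r := eval s a in (Nat (if r.1 is Nat _ then 1 else 0), r.2.+1)
  | Op o a b =>
      let ra := eval s a in let rb := eval s b in
      let m := natval ra.1 in let n := natval rb.1 in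
      (Nat (eval_op o m n), (ra.2 + rb.2 + (bits m).+1 * (bits n).+1)%N)
  | If c a b =>
      let rc := eval s c in
      let r := if natval rc.1 == 0%N then eval s b else eval s a in
      (r.1, (rc.2 + r.2).+1)
  | Let a b =>
      let ra := eval s a in let rb := eval (ra.1 :: s) b in
      (rb.1, (ra.2 + rb.2).+1)
  | Fold l a b =>
      let rl := eval s l in let ra := eval s a in
      let r := fold_data (fun x acc => eval [:: x, acc & s] b) rl.1 ra.1 in
      (r.1, (rl.2 + ra.2 + r.2).+1)
  end.

(* Length of an input in bits *)
Fixpoint data_size (d : data) : nat :=
  match d with
  | Nat n => bits n
  | Pair a b => (data_size a + data_size b).+1
  end.

Definition enc_seq (s : seq data) : data := foldr Pair (Nat 0) s.

(* Only used for nonnegative rationals *)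
Definition enc_rat (q : rat) : data := Pair (Nat `|numq q|%N) (Nat `|denq q|%N).

Definition enc_instance (I : instance) : data :=
  enc_seq [:: Nat (directed I); Nat (nV I);
    enc_seq [seq enc_seq [:: Nat (ends e).1; Nat (ends e).2;
                             enc_rat (weight e); enc_rat (len e)]
            | e <- enum (edge I)];
    enc_seq [seq enc_seq [:: Nat (terminals i).1; Nat (terminals i).2;
                             enc_rat (demand i)]
            | i <- enum 'I_(nK I)]].

(* The list of the indices of the edges in F, in increasing order *)
Definition enc_spanner (I : instance) (F : {set edge I}) : data :=
  enc_seq [seq Nat (nat_of_ord e) | e <- enum F].

(* The algorithm A, run on the instances in dom, is carried out by a program
   whose running time is polynomial in the length of the input. *)
Definition polynomial_time (dom : instance -> Prop)
    (A : forall I : instance, {set edge I}) : Prop :=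
  exists (P : exp) (c k : nat), forall I : instance, dom I ->
    let r := eval [:: enc_instance I] P in
    r.1 = enc_spanner (A I) /\
    (r.2 <= c * data_size (enc_instance I) ^ k + c)%N.

(* Main.v *)
Require Import Defs.
From HB Require Import structures.
From mathcomp Require Import all_boot all_order all_algebra.
From mathcomp Require Import constructive_ereal.
From mathcomp Require Import zify.

(** The optimum is at least the largest weight of its edges, hence at least the
    threshold, and at least the weight of a minimum spanning tree when every
    feasible spanner is connected; the output only uses edges of at most this
    weight, and is empty when the empty spanner is feasible.

    For the running time, all rationals are scaled by the product of their
    denominators. With m edges, giving the i-th edge the cost 2 ^ m L + 2 ^ i,
    where L is its scaled length, breaks ties as in [not_longer], and the m low
    bits of the cost of a path spell out its edge set. So Bellman-Ford distances
    for these costs, a maximal value standing for infinity, yield distances,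
    feasibility and the edges of the shortest paths at once; no paths are ever
    reconstructed, and all edge sets are bit masks. An edge belongs to the
    minimum spanning tree iff its ends are not connected by strictly cheaper
    edges, for the weights with ties broken in the same way, which again is a
    question about distances. *)

Set Implicit Arguments.
Unset Strict Implicit.
Unset Printing Implicit Defensive.

Import Order.TTheory GRing.Theory Num.Theory.

Local Open Scope ring_scope.

(** * Walks and shortest paths *)

(** [polynomial_time] only compares the output of a program with that of the algorithm, so the
    program need not follow its control flow: a minimum over all edges replaces the binary search,
    and a double loop that picks the pair of each rank replaces sorting. Ties between pairs must
    still be resolved exactly as by [sort], since the order can change the output.

    The language has no loop except the fold over a list, no arrays and no exponentiation; this is
    why labels sit on edges, edge lists serve as loop counters and powers of two are stored with the
    edges. A fold can square its accumulator in each step, so few steps alone do not mean polynomial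
    time: the size of all intermediate numbers has to be controlled. Every program is therefore
    verified relative to a number [M] that bounds list lengths and the bit length of operands; given
    [M], the time is bounded by an expression in the program text alone, polynomial in [M]. Here [M]
    is quadratic in the input length, as a common denominator multiplies up to linearly many numbers
    of linear bit length. *)

Section Walks.
Variable G : graph.
Implicit Types (F : {set edge G}) (e : edge G) (x y u v : node G).
Implicit Types p q : seq (edge G * node G).

Lemma is_walk_sub F F' u p v :
  F \subset F' -> is_walk F u p v -> is_walk F' u p v.
Proof.
move=> /subsetP sFF'; elim: p u => [|[e y] p IHp] u //= /and3P[/sFF' -> ->].
exact: IHp.
Qed.

Lemma is_path_sub F F' u p v :
  F \subset F' -> is_path F u p v -> is_path F' u p v.
Proof. by move=> sF /andP[/(is_walk_sub sF) w un]; apply/andP. Qed.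

Lemma is_walk_edges F u p v : is_walk F u p v -> {subset unzip1 p <= F}.
Proof.
elim: p u => [|[e y] p IHp] u //= /and3P[eF _ /IHp sub] f.
by rewrite inE => /predU1P[->|/sub].
Qed.

Lemma is_walk_restrict F F' u p v :
  is_walk F u p v -> {subset unzip1 p <= F'} -> is_walk F' u p v.
Proof.
elim: p u => [|[e y] p IHp] u //= /and3P[_ -> wp] sub.
rewrite sub ?mem_head //=; apply: IHp wp _ => f fp.
by apply: sub; rewrite inE fp orbT.
Qed.

Lemma is_path_suffix F y p v u :
  is_path F y p v -> u \in y :: unzip2 p ->
  exists2 q, is_path F u q v & suffix q p.
Proof.
elim: p y => [|[e z] p IHp] y.
  by move=> pp; rewrite inE => /eqP->; exists [::].
move=> pp; rewrite inE => /predU1P[->|up].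
  by exists ((e, z) :: p); rewrite ?suffix_refl.
have /andP[/= /and3P[_ _ w] /andP[_ un]] := pp.
have [|q pq sq] := IHp z _ up; first by apply/andP.
by exists q => //; apply: suffix_trans sq _; exact: (suffix_suffix [:: _] _).
Qed.

Lemma sum_suffix (c : edge G -> nat) p q :
  suffix p q -> (\sum_(s <- p) c s.1 <= \sum_(s <- q) c s.1)%N.
Proof. by case/suffixP=> r ->; rewrite big_cat leq_addl. Qed.

(** Cycles are cut out from the end: if the first node already lies on the path obtained from the
    rest, the path is taken from its occurrence there. Costs are natural numbers, so dropping steps
    cannot increase the sum. Bellman-Ford produces walks, whereas distances are defined by paths. *)
Lemma walk_to_path (c : edge G -> nat) F u p v :
  is_walk F u p v ->
  exists2 q, is_path F u q v &
    (\sum_(s <- q) c s.1 <= \sum_(s <- p) c s.1)%N.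
Proof.
elim: p u => [|[e y] p IHp] u /=.
  by exists [::]; rewrite // /is_path /= andbT.
case/and3P=> eF ej /IHp[q pq lq].
have [uq|uq] := boolP (u \in y :: unzip2 q).
  have [r pr sr] := is_path_suffix pq uq; exists r => //.
  by rewrite big_cons (leq_trans (sum_suffix c sr)) // (leq_trans lq) ?leq_addl.
exists ((e, y) :: q); last by rewrite !big_cons leq_add2l.
by case/andP: pq => wq unq; rewrite /is_path /= -/(uniq (y :: _)) eF ej wq unq uq.
Qed.

Lemma joins_ends e x y : joins e x y ->
  (x, y) = ends e \/ (y, x) = ends e.
Proof.
case/orP=> [/eqP->|/andP[_ /eqP->]]; first by left.
by right.
Qed.

Lemma walk_edge_nodes F y p v e a b : is_walk F y p v -> e \in unzip1 p ->
  joins e a b -> a \in y :: unzip2 p.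
Proof.
elim: p y => [|[f z] p IHp] y //= /and3P[_ jf wp].
rewrite inE => /predU1P[ef|ep] je; last first.
  by rewrite inE (IHp z) ?orbT.
rewrite ef in je.
have [h1|h1] := joins_ends je; have [h2|h2] := joins_ends jf; move: h2;
  rewrite -h1 => -[-> ->]; by rewrite !inE eqxx ?orbT.
Qed.

(** An edge used twice would bring the path back to the node from which it was first traversed.
    Hence sums over steps are sums over edge sets, and bit masks do not carry. *)
Lemma path_uniq_edges F u p v : is_path F u p v -> uniq (unzip1 p).
Proof.
elim: p u => [|[e y] p IHp] u //= /andP[/= /and3P[_ je wp] /andP[up un]].
apply/andP; split; last by apply: (IHp y); apply/andP.
by apply/negP=> ep; case/negP: up; exact: walk_edge_nodes wp ep je.
Qed.

Lemma path_size F u p v : is_path F u p v -> (size p <= nV G)%N.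
Proof.
case/andP=> _ /card_uniqP /= un.
have := max_card (mem (u :: unzip2 p)); rewrite un card_ord size_map.
exact: ltnW.
Qed.

(** This justifies as many Bellman-Ford rounds as there are edges: the program has a list of edges
    to count with, but none of nodes. *)
Lemma path_size_edges F u p v : is_path F u p v -> (size p <= nE G)%N.
Proof.
move/path_uniq_edges/card_uniqP => /=; rewrite size_map => <-.
by rewrite -[X in (_ <= X)%N]card_ord max_card.
Qed.

Lemma path_steps F u p v : is_path F u p v ->
  exists2 q : steps G, is_path F u q v & val q = p.
Proof. by move=> pp; exists (Bseq (path_size pp)). Qed.

Definition connects F u v := [exists p : steps G, is_path F u p v].

Lemma walk_connects F u p v : is_walk F u p v -> connects F u v.
Proof.
move=> /(walk_to_path (fun=> 0%N))[q /path_steps[r pr _] _].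
by apply/existsP; exists r.
Qed.

(** The value [+oo] of the empty minimum exceeds every rational, so a finite bound is always
    witnessed by a path. *)
Lemma dist_leP (len : edge G -> rat) F u v (d : rat) :
  reflect (exists2 p : steps G, is_path F u p v & path_length len p <= d)
          (dist len F u v <= d%:E)%E.
Proof.
apply: (iffP idP) => [|[p pp lp]]; last first.
  by apply: (bigmin_inf p) => //; rewrite lee_fin.
rewrite leNgt => dd; have [/existsP[p /andP[pp lp]]|] :=
    boolP [exists p : steps G, is_path F u p v && (path_length len p <= d)].
  by exists p.
rewrite negb_exists => /forallP h; case/negP: dd.
apply/bigmin_gtP; split; first exact: ltry.
by move=> p pp; rewrite lte_fin ltNge; have := h p; rewrite pp.
Qed.

(** [not_longer] is lexicographic: first the length is minimized, then the perturbation among the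
    paths of minimum length. *)
Lemma shortest_path_exists (len : edge G -> rat) F u v :
  connects F u v ->
  exists2 p : steps G, is_path F u p v &
    [forall q : steps G, is_path F u q v ==> not_longer len p q].
Proof.
case/existsP=> p0 pp0.
case: (@arg_minP _ _ _ p0 (fun p : steps G => is_path F u p v)
         (path_length len) pp0) => p1 pp1 min1.
pose P := fun p : steps G =>
  is_path F u p v && (path_length len p == path_length len p1).
have Pp1 : P p1 by rewrite /P pp1 eqxx.
case: (@arg_minnP _ p1 P (@perturbation G) Pp1) => p /andP[pp /eqP lp] min2.
exists p => //; apply/forallP=> q; apply/implyP=> pq; rewrite /not_longer lp.
have := min1 q pq; rewrite le_eqVlt => /orP[e|->] //.
rewrite e orbC min2 // /P pq /=; by rewrite eq_sym.
Qed.

Lemma shortest_pathP (len : edge G -> rat) F u v :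
  if shortest_path len F u v is Some p then
    is_path F u p v /\ (forall q : steps G, is_path F u q v -> not_longer len p q)
  else ~~ connects F u v.
Proof.
rewrite /shortest_path; case: pickP => [p /andP[pp /forallP h]|h].
  by split=> // q pq; move/implyP: (h q); apply.
apply/negP=> /(shortest_path_exists len)[p pp hp].
by have := h p; rewrite pp hp.
Qed.

Lemma shortest_path_dist (len : edge G -> rat) F u v (p : steps G) :
  shortest_path len F u v = Some p -> dist len F u v = (path_length len p)%:E.
Proof.
move=> e; have := shortest_pathP len F u v; rewrite e => -[pp h].
apply/eqP; rewrite eq_le; apply/andP; split.
  by apply/dist_leP; exists p.
apply/bigmin_geP; split; first exact: leey.
move=> q /h; rewrite lee_fin => /orP[/ltW//|/andP[/eqP-> _]//].
Qed.

Lemma not_connects_dist (len : edge G -> rat) F u v :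
  ~~ connects F u v -> dist len F u v = +oo%E.
Proof.
rewrite negb_exists => /forallP h; rewrite /dist big_pred0 // => p.
exact: negbTE (h p).
Qed.

Lemma path_edges_sub F u (p : steps G) v :
  is_path F u p v -> path_edges p \subset F.
Proof. by case/andP=> w _; apply/subsetP=> e; rewrite inE => /(is_walk_edges w). Qed.

Lemma path_edges_path F u (p : steps G) v :
  is_path F u p v -> is_path (path_edges p) u p v.
Proof.
case/andP=> w un; rewrite /is_path un andbT.
by apply: is_walk_restrict w _ => f; rewrite inE.
Qed.

End Walks.

(** * Feasibility and weight of the output *)

Section Approximation.
Variable I : instance.
Implicit Types (F H : {set edge I}).

Lemma tdist_sub F F' (i : 'I_(nK I)) (d : rat) :
  F \subset F' -> (tdist F i <= d%:E)%E -> (tdist F' i <= d%:E)%E.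
Proof.
move=> sF /dist_leP[p pp lp]; apply/dist_leP; exists p => //.
exact: is_path_sub sF pp.
Qed.

Lemma feasible_sub F F' : F \subset F' -> feasible F -> feasible F'.
Proof. by move=> sF /forallP h; apply/forallP=> i; apply: tdist_sub (h i). Qed.

(** The local function of [greedy], made global so that single steps of the fold can be reasoned
    about. *)
Definition add_pair F H (i : 'I_(nK I)) :=
  if (tdist H i <= (demand i)%:E)%E then H
  else if shortest_path (@len I) F (terminals i).1 (terminals i).2 is Some p
       then H :|: path_edges p
       else H.

Lemma greedyE F : greedy F = foldl (add_pair F) set0
    (sort (fun i j => (tdist F i <= tdist F j)%E) (enum 'I_(nK I))).
Proof. by []. Qed.

Lemma add_pair_sup F H (i : 'I_(nK I)) : H \subset add_pair F H i.
Proof.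
rewrite /add_pair; case: ifP => // _; case: shortest_path => // p.
exact: subsetUl.
Qed.

Lemma add_pair_sub F H (i : 'I_(nK I)) : H \subset F -> add_pair F H i \subset F.
Proof.
rewrite /add_pair; case: ifP => // _ sH.
have := shortest_pathP (@len I) F (terminals i).1 (terminals i).2.
by case: shortest_path => // p [/path_edges_sub sp _]; rewrite subUset sH.
Qed.

Lemma add_pair_feasible F H (i : 'I_(nK I)) : (tdist F i <= (demand i)%:E)%E ->
  (tdist (add_pair F H i) i <= (demand i)%:E)%E.
Proof.
move=> hF; rewrite /add_pair; case: ifP => // _.
have := shortest_pathP (@len I) F (terminals i).1 (terminals i).2.
case e: shortest_path => [p|]; last first.
  by move/(@not_connects_dist _ (@len I)); rewrite -/(tdist F i) => eF; rewrite eF in hF.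
case=> pp _; apply: (@tdist_sub (path_edges p)); first exact: subsetUr.
apply/dist_leP; exists p; first exact: path_edges_path pp.
by move: hF; rewrite /tdist (shortest_path_dist e) lee_fin.
Qed.

Lemma foldl_add_pair_sup F s H : H \subset foldl (add_pair F) H s.
Proof.
by elim: s H => [|i s IHs] H //=; apply: subset_trans (add_pair_sup F H i) (IHs _).
Qed.

Lemma greedy_sub F : greedy F \subset F.
Proof.
rewrite greedyE; elim/last_ind: (sort _ _) => [|s i IHs]; first exact: sub0set.
by rewrite foldl_rcons add_pair_sub.
Qed.

(** Each pair is satisfied right after it has been processed, and later steps only add edges. *)
Lemma greedy_feasible F : feasible F -> feasible (greedy F).
Proof.
move=> /forallP fF; apply/forallP=> i; rewrite greedyE.
have : i \in sort (fun i j => (tdist F i <= tdist F j)%E) (enum 'I_(nK I)).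
  by rewrite mem_sort mem_enum.
case/splitPr=> s1 s2; rewrite foldl_cat /=.
by apply: tdist_sub (foldl_add_pair_sup _ _ _) _; apply: add_pair_feasible.
Qed.

(** This covers an optimum without edges: it has weight 0, while the threshold is the weight of some
    edge and may be positive. *)
Lemma greedy0 F : feasible (set0 : {set edge I}) -> greedy F = set0 :> {set edge I}.
Proof.
move=> /forallP f0; rewrite greedyE.
elim: (sort _ _) => [|i s IHs] //=.
by rewrite [add_pair _ _ _]/add_pair f0.
Qed.

Lemma total_weight_ge0 F : 0 <= total_weight F.
Proof. by apply: sumr_ge0 => e _; apply: weight_ge0. Qed.

Lemma total_weight_sub F F' : F \subset F' -> total_weight F <= total_weight F'.
Proof.
move=> sF; rewrite /total_weight [leRHS](big_setID F) /= (setIidPr sF).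
by rewrite lerDl sumr_ge0 // => e _; apply: weight_ge0.
Qed.

Lemma weight_le_total F e : e \in F -> weight e <= total_weight F.
Proof.
move=> eF; rewrite /total_weight (big_setD1 e) //= lerDl.
by apply: sumr_ge0 => f _; apply: weight_ge0.
Qed.

Lemma OPT_attained : (exists F : {set edge I}, feasible F) ->
  exists2 F : {set edge I}, feasible F & total_weight F = OPT I.
Proof.
rewrite /OPT; case=> F fF; have [|F' fF' ->] := @eq_bigmin _ _ _ (total_weight [set: edge I]) F
   (fun F : {set edge I} => feasible F) (@total_weight I) fF; last by exists F'.
by move=> H _; apply/total_weight_sub/subsetT.
Qed.

(** Monotonicity is asked for up to [hi] only, as reading the list of weights beyond its end yields
    the default 0. The search maintains that [P hi] holds. *)
Lemma binary_searchP (P : pred nat) fuel lo hi :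
  (forall i j, (i <= j <= hi)%N -> P i -> P j) -> P hi -> (lo <= hi)%N ->
  (hi - lo <= fuel)%N ->
  [/\ P (binary_search P fuel lo hi), (binary_search P fuel lo hi <= hi)%N &
      forall i, (lo <= i < binary_search P fuel lo hi)%N -> ~~ P i].
Proof.
elim: fuel lo hi => [|fuel IH] lo hi mono Phi lohi hfuel /=.
  have e : lo = hi by lia.
  by rewrite e; split=> // i; lia.
case: ifP => [hl|hl].
  have e : lo = hi by lia.
  by rewrite e; split=> // i; lia.
set mid := (lo + hi)./2; have [ml mh] : (lo <= mid /\ mid < hi)%N by lia.
case: ifP => Pm.
  have mono' i j : (i <= j <= mid)%N -> P i -> P j.
    by move=> ij; apply: mono; lia.
  have fu : (mid - lo <= fuel)%N by lia.
  have [h1 h2 h3] := IH lo mid mono' Pm ml fu.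
  by split=> //; lia.
have fu : (hi - mid.+1 <= fuel)%N by lia.
have [h1 h2 h3] := IH mid.+1 hi mono Phi mh fu.
split=> // i ib; have [mi|im] := ltnP mid i; first by apply: h3; lia.
by apply/negP=> Pi; have := mono i mid _ Pi; rewrite Pm => /(_ ltac:(lia)).
Qed.

Lemma light_edges_sub (w w' : rat) : w <= w' -> light_edges I w \subset light_edges I w'.
Proof. by move=> ww'; apply/subsetP=> e; rewrite !inE => /le_trans; apply. Qed.

Lemma mem_sorted_weights (w : rat) :
  reflect (exists e : edge I, w = weight e) (w \in sorted_weights I).
Proof.
rewrite mem_sort mem_undup; apply: (iffP mapP) => [[e _ ->]|[e ->]].
  by exists e.
by exists e; rewrite ?mem_enum.
Qed.

Lemma sorted_sorted_weights : sorted <=%R (sorted_weights I).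
Proof. exact: (sort_sorted (@le_total _ _)). Qed.

Lemma size_sorted_weights : (0 < size (sorted_weights I))%N.
Proof.
pose e : edge I := Ordinal (edges_gt0 I).
have : weight e \in sorted_weights I by apply/mem_sorted_weights; exists e.
by case: (sorted_weights I).
Qed.

Lemma threshold_spec : (exists F : {set edge I}, feasible F) ->
  [/\ exists e : edge I, threshold I = weight e,
      feasible (light_edges I (threshold I)) &
      forall e : edge I, feasible (light_edges I (weight e)) ->
        threshold I <= weight e].
Proof.
case=> F fF; rewrite /threshold; set W := sorted_weights I.
have W0 : (0 < size W)%N := size_sorted_weights.
have leW (i j : nat) : (i <= j < size W)%N -> W`_i <= W`_j.
  case/andP=> ij jW; apply: (sorted_leq_nth le_trans lexx) => //.
    exact: sorted_sorted_weights.
  by rewrite inE; apply: leq_ltn_trans jW.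
have [||||h1 h2 h3] := @binary_searchP
    (fun i => feasible (light_edges I W`_i)) (size W) 0 (size W).-1.
- move=> i j ij; apply/feasible_sub/light_edges_sub/leW; lia.
- apply: feasible_sub fF; apply/subsetP=> e _; rewrite inE.
  have /(nthP 0)[j jW <-] : weight e \in W by apply/mem_sorted_weights; exists e.
  by apply: leW; rewrite -ltnS (ltn_predK W0) jW leqnn.
- by [].
- by rewrite subn0 leq_pred.
split=> //.
  by apply/mem_sorted_weights/mem_nth; rewrite (leq_ltn_trans h2) ?(ltn_predK W0).
move=> e; have /(nthP 0)[j jW <-] : weight e \in W.
  by apply/mem_sorted_weights; exists e.
move=> fj; apply: leW; rewrite jW andbT leqNgt.
by apply/negP=> jb; have := h3 j jb; rewrite fj.
Qed.

Lemma greedy_light_feasible (w : rat) : (exists F : {set edge I}, feasible F) ->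
  threshold I <= w -> feasible (greedy (light_edges I w)).
Proof.
move=> /threshold_spec[_ ft _] tw; apply: greedy_feasible.
exact: feasible_sub (light_edges_sub tw) ft.
Qed.

(** The output lies in [light_edges I w], so each of its at most m edges weighs at most [w], hence
    at most the whole of [F]. For the empty [F] no such bound on [w] is available, but then the
    output is empty. *)
Lemma greedy_light_weight (w : rat) F : feasible F ->
  (F != set0 -> w <= total_weight F) ->
  total_weight (greedy (light_edges I w)) <= (nE I)%:R * total_weight F.
Proof.
have [->|F0] := eqVneq F set0.
  by move=> f0 _; rewrite greedy0 // /total_weight big_set0 mulr0.
move=> fF /(_ isT) wF; apply: (@le_trans _ _ (total_weight (light_edges I w))).
  exact/total_weight_sub/greedy_sub.
have -> : (nE I)%:R * total_weight F = \sum_(e : edge I) total_weight F.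
  by rewrite sumr_const card_ord mulr_natl.
rewrite /total_weight big_mkcond; apply: ler_sum => e _; case: ifP.
  by rewrite inE => /le_trans; apply.
by move=> _; apply: total_weight_ge0.
Qed.

(** No edge of [F] is heavier than its heaviest edge [e], so the subgraph for the candidate
    [weight e] contains [F] and is feasible. *)
Lemma threshold_le_weight F : feasible F -> F != set0 ->
  threshold I <= total_weight F.
Proof.
move=> fF /set0Pn[e0 e0F].
have [_ _ tmin] := threshold_spec (ex_intro _ F fF).
case: (@arg_maxP _ _ _ e0 (fun e => e \in F) (@weight I) e0F) => e eF emax.
apply: le_trans (weight_le_total eF); apply: tmin; apply: feasible_sub fF.
by apply/subsetP=> f fF; rewrite inE; apply: emax.
Qed.

End Approximation.

(** * Minimum spanning trees *)

Section Connectivity.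
Variable G : graph.
Implicit Types (A B F T : {set edge G}) (e f : edge G) (x y u v : node G).

Lemma adjacent_sym F : symmetric (adjacent F).
Proof. by move=> x y; apply: eq_existsb => e; rewrite orbC. Qed.

Lemma adjacent_connect_sym F : connect_sym (adjacent F).
Proof. exact/sym_connect_sym/adjacent_sym. Qed.

Lemma adjacent_ends F e : e \in F -> adjacent F (ends e).1 (ends e).2.
Proof.
move=> eF; apply/existsP; exists e; rewrite eF /joins /same_pair.
by rewrite -surjective_pairing eqxx.
Qed.

Lemma adjacentP F x y : adjacent F x y ->
  exists2 e, e \in F & ends e = (x, y) \/ ends e = (y, x).
Proof.
case/existsP=> e /andP[eF b]; exists e => //.
by case/orP: b => /joins_ends[]; auto.
Qed.

Lemma connect_ends A B u v :
  (forall e, e \in A -> connect (adjacent B) (ends e).1 (ends e).2) ->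
  connect (adjacent A) u v -> connect (adjacent B) u v.
Proof.
move=> h; move: u v; apply: connect_sub => x y /adjacentP[e /h].
move=> + he; case: he => -> //=.
by rewrite adjacent_connect_sym.
Qed.

Lemma connect_adjacent_sub A B u v : A \subset B ->
  connect (adjacent A) u v -> connect (adjacent B) u v.
Proof.
move=> /subsetP sAB; apply: connect_ends => e /sAB eB.
exact/connect1/adjacent_ends.
Qed.

(** The induction follows a walk and discards every detour that leaves an end of [f] and returns to
    it; what remains uses [f] at most once, in one of the two directions. *)
Lemma connect_remove A f u v : connect (adjacent A) u v ->
  [\/ connect (adjacent (A :\ f)) u v,
      connect (adjacent (A :\ f)) u (ends f).1 /\
        connect (adjacent (A :\ f)) (ends f).2 v |
      connect (adjacent (A :\ f)) u (ends f).2 /\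
        connect (adjacent (A :\ f)) (ends f).1 v].
Proof.
case/connectP=> p; elim: p u => [|y p IHp] u /=.
  by move=> _ ->; constructor 1; apply: connect0.
case/andP=> /adjacentP[e eA he] pp lp.
have := IHp y pp lp; have [ef|ef] := eqVneq e f.
  rewrite ef in he; case: he => -> /= [h|[h1 h2]|[h1 h2]].
  - by constructor 2; split.
  - by constructor 2; split.
  - by constructor 1.
  - by constructor 3; split.
  - by constructor 1.
  - by constructor 3; split.
have uy : connect (adjacent (A :\ f)) u y.
  apply: connect1; have /adjacent_ends : e \in A :\ f by rewrite !inE ef.
  by case: he => -> //=; rewrite adjacent_sym.
case=> [h|[h1 h2]|[h1 h2]].
- by constructor 1; apply: connect_trans uy h.
- by constructor 2; split=> //; apply: connect_trans uy h1.
- by constructor 3; split=> //; apply: connect_trans uy h1.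
Qed.

Lemma connectedP F : reflect (forall x y, connect (adjacent F) x y) (connected F).
Proof. exact: 'forall_forallP. Qed.

(** Spanning trees are defined by [connect], distances by the paths behind [connects]; this bridge
    lets distances answer the spanning tree question. *)
Lemma connect_undirected F u v : ~~ directed G ->
  connect (adjacent F) u v = connects F u v.
Proof.
move=> und; apply/idP/idP => [/connectP[p]|/existsP[p /andP[+ _]]].
  suff h w : path (adjacent F) u p -> w = last u p -> exists q, is_walk F u q w.
    by move=> /h {}h /h[q]; apply: walk_connects.
  elim: p u => [|y p IHp] u /=; first by move=> _ ->; exists [::] => /=.
  case/andP=> /existsP[e /andP[eF je]] /IHp{}IHp /IHp[q wq].
  exists ((e, y) :: q); rewrite /= eF wq andbT.
  by move: je; rewrite /joins /same_pair und /= orbC;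
    case/orP=> /orP[]/eqP->; rewrite /= eqxx ?orbT.
elim: (val p) u => [|[e y] q IHq] u /=; first by move/eqP->; apply: connect0.
case/and3P=> eF je /IHq; apply: connect_trans; apply: connect1.
by apply/existsP; exists e; rewrite eF je.
Qed.

Lemma minimal_connected_acyclic F : connected F ->
  (forall e, e \in F -> ~~ connected (F :\ e)) -> acyclic F.
Proof.
move=> cF minF; apply/forall_inP => e eF; apply: contra (minF e eF) => h.
apply/connectedP=> u v; move/connectedP: cF => /(_ u v).
apply: connect_ends => g gF; have [->//|ge] := eqVneq g e.
by apply/connect1/adjacent_ends; rewrite !inE ge gF.
Qed.

Lemma connected_spanning_tree F : connected F ->
  exists2 T : {set edge G}, spanning_tree T & T \subset F.
Proof.
move=> cF; pose P T := (T \subset F) && connected T.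
have PF : P F by rewrite /P subxx.
case: (@arg_minnP _ F P (fun T => #|T|) PF) => T /andP[sT cT] minT.
exists T => //; rewrite /spanning_tree cT; apply: minimal_connected_acyclic => // e eT.
apply/negP=> h; have := minT (T :\ e).
rewrite /P h (subset_trans (subD1set _ _) sT) => /(_ isT).
by rewrite (cardsD1 e T) eT ltnn.
Qed.

End Connectivity.

(** * Kruskal edges for distinct positive costs *)

Section Kruskal.
Variable G : graph.
Variable c : edge G -> nat.
Hypotheses (c_inj : injective c) (c_gt0 : forall e, (0 < c e)%N).
Hypothesis conG : connected [set: edge G].
Implicit Types (A B F T : {set edge G}) (e f : edge G).

Definition lighter e := [set f | (c f < c e)%N].

Definition kruskal :=
  [set e | ~~ connect (adjacent (lighter e)) (ends e).1 (ends e).2].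

(** By induction on the cost, the ends of an edge that is not selected are joined by cheaper edges,
    whose ends are in turn joined by selected ones. *)
Lemma kruskal_connected : connected kruskal.
Proof.
have ke e : connect (adjacent kruskal) (ends e).1 (ends e).2.
  have [n] := ubnP (c e); elim: n e => // n IHn e; rewrite ltnS => cen.
  have [ek|] := boolP (e \in kruskal); first exact/connect1/adjacent_ends.
  rewrite inE negbK; apply: connect_ends => f; rewrite inE => fe.
  by apply: IHn; apply: leq_trans fe cen.
apply/connectedP=> x y; move/connectedP: conG => /(_ x y).
by apply: connect_ends.
Qed.

(* If e were a Kruskal edge outside F, then an inclusion-minimal subset of F
   connecting the ends of e would contain a heavier edge f, and exchanging f
   for e would improve F. *)
Lemma kruskal_sub_min F : connected F ->
  (forall F', connected F' -> (\sum_(e in F) c e <= \sum_(e in F') c e)%N) ->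
  kruskal \subset F.
Proof.
move=> cF minF; apply/subsetP=> e; rewrite inE => ek.
apply/negPn/negP=> eF; set x := (ends e).1 in ek *; set y := (ends e).2 in ek *.
pose P A := (A \subset F) && connect (adjacent A) x y.
have PF : P F by rewrite /P subxx /=; apply/connectedP.
case: (@arg_minnP _ F P (fun A => #|A|) PF) => A /andP[sAF cA] minA.
have /subsetPn[f fA fe] : ~~ (A \subset lighter e).
  by apply: contra ek => /connect_adjacent_sub; apply.
have fF : f \in F by apply: (subsetP sAF).
have nef : f != e by apply: contraNneq eF => <-.
have cef : (c e < c f)%N.
  rewrite ltn_neqAle; move: fe; rewrite inE -leqNgt => ->.
  by rewrite andbT; apply: contra nef => /eqP/c_inj->.
have sAf : A :\ f \subset e |: F :\ f.
  by apply: subset_trans (setSD _ sAF) (subsetUr _ _).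
have ncA : ~~ connect (adjacent (A :\ f)) x y.
  apply/negP=> h; have := minA (A :\ f).
  rewrite /P h (subset_trans (subD1set _ _) sAF) => /(_ isT).
  by rewrite (cardsD1 f A) fA ltnn.
have xy : connect (adjacent (e |: F :\ f)) x y.
  by apply/connect1/adjacent_ends/setU11.
(* As [A] is minimal, it joins [x] and [y] only through [f]; so [x] and [y] are each still joined to
   a different end of [f], and [e] reconnects these ends. *)
have cf : connect (adjacent (e |: F :\ f)) (ends f).1 (ends f).2.
  case: (connect_remove f cA) => [h|[h1 h2]|[h1 h2]].
  - by rewrite h in ncA.
  - have /(connect_adjacent_sub sAf) := h1; rewrite adjacent_connect_sym => h.
    apply: connect_trans h _; apply: connect_trans xy _.
    by rewrite adjacent_connect_sym; apply: connect_adjacent_sub h2.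
  - rewrite adjacent_connect_sym.
    have /(connect_adjacent_sub sAf) := h1; rewrite adjacent_connect_sym => h.
    apply: connect_trans h _; apply: connect_trans xy _.
    by rewrite adjacent_connect_sym; apply: connect_adjacent_sub h2.
have /minF : connected (e |: F :\ f).
  apply/connectedP=> u v; move/connectedP: cF => /(_ u v).
  apply: connect_ends => g gF; have [->//|gf] := eqVneq g f.
  by apply/connect1/adjacent_ends; rewrite !inE gf gF orbT.
rewrite big_setU1 ?inE ?(negbTE eF) ?andbF //= (big_setD1 f fF) /=.
by rewrite leq_add2r leqNgt cef.
Qed.

(** A cheapest connected set [F] contains all Kruskal edges. These are connected themselves, so by
    positivity any additional edge would make [F] too expensive, and the two sets agree. Positivity
    also rules out cycles in [F]. *)
Lemma kruskal_min :
  [/\ spanning_tree kruskal & forall F, connected F ->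
      (\sum_(e in kruskal) c e <= \sum_(e in F) c e)%N].
Proof.
case: (@arg_minnP _ setT (@connected G) (fun F => \sum_(e in F) c e)%N conG).
move=> F cF minF; have sk := kruskal_sub_min cF minF.
have eFk : (\sum_(e in F) c e <= \sum_(e in kruskal) c e)%N.
  exact/minF/kruskal_connected.
have kF : kruskal = F.
  apply/eqP; rewrite eqEsubset sk; apply/subsetP=> e eF; apply/negPn/negP=> ek.
  move: eFk; rewrite (big_setID kruskal) /= (setIidPr sk).
  have e' : e \in F :\: kruskal by rewrite in_setD ek eF.
  by rewrite (big_setD1 e e') /=; have := c_gt0 e; lia.
have aF : acyclic F.
  apply: minimal_connected_acyclic => // e eF; apply/negP=> /minF.
  by rewrite (big_setD1 e eF) /= -[leqRHS]add0n leq_add2r leqNgt c_gt0.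
by rewrite /spanning_tree kF cF aF.
Qed.

End Kruskal.

Lemma MST_weight_le_connected (I : instance) (F : {set edge I}) :
  connected F -> MST_weight I <= total_weight F.
Proof.
case/connected_spanning_tree=> T tT sT; apply: le_trans (total_weight_sub sT).
exact: bigmin_le_cond.
Qed.

(** * Bit masks and Bellman-Ford *)

Section Bits.

Definition testbit (n i : nat) : bool := odd (n %/ 2 ^ i).

Lemma bits_lt (b : nat -> bool) m : (\sum_(i < m) b i * 2 ^ i < 2 ^ m)%N.
Proof.
elim: m => [|m IHm]; first by rewrite big_ord0.
rewrite big_ord_recr /= expnS mul2n -addnn -addSn leq_add //.
by case: (b m); rewrite ?mul1n.
Qed.

Lemma bits_testbit (b : nat -> bool) m j :
  (j < m)%N -> testbit (\sum_(i < m) b i * 2 ^ i) j = b j.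
Proof.
rewrite /testbit; elim: m => // m IHm; rewrite ltnS leq_eqVlt big_ord_recr /=.
case/predU1P=> [->|jm].
  by rewrite divnDMl ?expn_gt0 // divn_small ?bits_lt // add0n oddb.
(* The top bit contributes an even multiple of [2 ^ j], which parity does not see. *)
have -> : (b m * 2 ^ m = (b m * 2 ^ (m - j.+1)) * 2 * 2 ^ j)%N.
  by rewrite -!mulnA -expnS -expnD subnK.
by rewrite divnDMl ?expn_gt0 // oddD oddM andbF addbF IHm.
Qed.

End Bits.

Section FoldMin.
Variables (T : eqType) (f : T -> nat).

Definition fold_min (a : nat) (s : seq T) := foldl (fun a x => minn a (f x)) a s.

Lemma fold_min_geP n a s :
  (n <= fold_min a s)%N = (n <= a)%N && all (fun x => n <= f x)%N s.
Proof.
rewrite /fold_min; elim: s a => [|x s IHs] a /=; first by rewrite andbT.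
by rewrite IHs leq_min andbA.
Qed.

Lemma fold_min_le a s : (fold_min a s <= a)%N.
Proof. by have := fold_min_geP (fold_min a s) a s; rewrite leqnn => /esym/andP[]. Qed.

Lemma fold_min_le_mem a s x : x \in s -> (fold_min a s <= f x)%N.
Proof.
have := fold_min_geP (fold_min a s) a s; rewrite leqnn => /esym/andP[_ /allP h].
exact: h.
Qed.

Lemma fold_min_attained a s :
  fold_min a s = a \/ exists2 x, x \in s & fold_min a s = f x.
Proof.
rewrite /fold_min; elim: s a => [|x s IHs] a /=; first by left.
case: (IHs (minn a (f x))) => [->|[y ys ->]]; last first.
  by right; exists y; rewrite // inE ys orbT.
by rewrite /minn; case: ifP => _; [left | right; exists x; rewrite ?mem_head].
Qed.

End FoldMin.

Section Masks.
Variable n : nat.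
Implicit Types (F : {set 'I_n}) (e : 'I_n).

Definition mask F : nat := \sum_(e in F) 2 ^ e.

Definition mem_nat F (i : nat) : bool :=
  if insub i is Some e then (e : 'I_n) \in F else false.

Lemma maskE F : mask F = (\sum_(i < n) mem_nat F i * 2 ^ i)%N.
Proof.
rewrite /mask big_mkcond; apply: eq_bigr => i _; rewrite /mem_nat valK.
by case: ifP; rewrite ?mul1n.
Qed.

Lemma mask_lt F : (mask F < 2 ^ n)%N.
Proof. by rewrite maskE bits_lt. Qed.

Lemma mask_testbit F e : testbit (mask F) e = (e \in F).
Proof. by rewrite maskE bits_testbit // /mem_nat valK. Qed.

End Masks.

(** * Bellman-Ford with labels on edges *)

Section BellmanFord.
Variable G : graph.
Variables (inf : nat) (cost : edge G -> nat).
Implicit Types (F : {set edge G}) (e : edge G) (x y z u v : node G).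
Implicit Types D : edge G -> nat * nat.

(* (D e).1 and (D e).2 bound the cost of a walk to v that starts by traversing e
   forwards and backwards, respectively. *)
Definition best D v z : nat :=
  fold_min (fun e => minn (if (ends e).1 == z then (D e).1 else inf)
                          (if (ends e).2 == z then (D e).2 else inf))
    (if z == v then 0 else inf)%N (enum (edge G)).

Definition forward_cost F e := if e \in F then cost e else inf.
Definition backward_cost F e := if directed G then inf else forward_cost F e.

(** Labels are kept on edges, in both directions, because the program walks through a list of edge
    records and has no table indexed by nodes; [best] recovers a node label from them. Capping at
    [inf] keeps the numbers from growing. *)
Definition relax F v D e : nat * nat :=
  (minn inf (forward_cost F e + best D v (ends e).2),
   minn inf (backward_cost F e + best D v (ends e).1))%N.

Definition bellman_ford F v k := iter k (relax F v) (fun=> (inf, inf)).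

Lemma best_le D v z : (best D v z <= inf)%N.
Proof. by apply: leq_trans (fold_min_le _ _ _) _; case: ifP. Qed.

Lemma bellman_ford_le F v k e :
  ((bellman_ford F v k e).1 <= inf)%N /\ ((bellman_ford F v k e).2 <= inf)%N.
Proof. by case: k => [|k] //=; rewrite !geq_minl. Qed.

(** A value below [inf] can only come from [z] being the target or from an edge of [F] in an allowed
    direction, since every other contribution is at least [inf]. Following these choices through the
    rounds yields a walk of exactly this cost. *)
Lemma bellman_ford_sound F v k z : (best (bellman_ford F v k) v z < inf)%N ->
  exists2 p, is_walk F z p v & (\sum_(s <- p) cost s.1 = best (bellman_ford F v k) v z)%N.
Proof.
elim: k z => [|k IHk] z; rewrite [best _ _ _]/best.
  set b := fold_min _ _ _ => blt; have [e|[x _ e]] := fold_min_attained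
    (fun e => minn (if (ends e).1 == z then (bellman_ford F v 0 e).1 else inf)
              (if (ends e).2 == z then (bellman_ford F v 0 e).2 else inf))
    (if z == v then 0 else inf)%N (enum (edge G)).
  - rewrite -/b in e; exists [::].
      by move: blt; rewrite e /=; case: ifP => //; rewrite ltnn.
    by rewrite big_nil; move: blt; rewrite e; case: ifP => //; rewrite ltnn.
  - by rewrite -/b /= !if_same minnn in e; rewrite e ltnn in blt.
set b := fold_min _ _ _ => blt; have [e|[x _ e]] := fold_min_attained
    (fun e => minn (if (ends e).1 == z then (bellman_ford F v k.+1 e).1 else inf)
              (if (ends e).2 == z then (bellman_ford F v k.+1 e).2 else inf))
    (if z == v then 0 else inf)%N (enum (edge G)).
  rewrite -/b in e; exists [::].
    by move: blt; rewrite e /=; case: ifP => //; rewrite ltnn.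
  by rewrite big_nil; move: blt; rewrite e; case: ifP => //; rewrite ltnn.
rewrite -/b in e; move: (blt); rewrite e.
have step y : (cost x + best (bellman_ford F v k) v y < inf)%N -> x \in F ->
    joins x z y -> exists2 p, is_walk F z p v &
    (\sum_(s <- p) cost s.1 = cost x + best (bellman_ford F v k) v y)%N.
  move=> lt xF jx; have [|p wp ep] := IHk y; first by lia.
  by exists ((x, y) :: p); rewrite /= ?xF ?jx // big_cons ep.
rewrite [minn _ _]/minn; case: ifP => _; case: eqP => [ez|_]; rewrite ?ltnn //=.
- rewrite [minn _ _]/minn; case: ifP; rewrite ?ltnn // => _.
  rewrite /forward_cost; case: ifP => xF; last by lia.
  by move=> lt; apply: step => //; rewrite /joins /same_pair -ez -surjective_pairing eqxx.
- rewrite [minn _ _]/minn; case: ifP; rewrite ?ltnn // => _.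
  rewrite /backward_cost; case: ifP => dG; first by lia.
  rewrite /forward_cost; case: ifP => xF; last by lia.
  move=> lt; apply: step => //.
  by rewrite /joins /same_pair -ez dG /= -surjective_pairing eqxx orbT.
Qed.

Lemma bellman_ford_complete F v k z p : is_walk F z p v -> (size p <= k)%N ->
  (best (bellman_ford F v k) v z <= \sum_(s <- p) cost s.1)%N.
Proof.
elim: k z p => [|k IHk] z [|[e y] p] //=.
- by move=> /eqP-> _; rewrite big_nil (leq_trans (fold_min_le _ _ _)) ?eqxx.
- by move=> /eqP-> _; rewrite big_nil (leq_trans (fold_min_le _ _ _)) ?eqxx.
case/and3P=> eF je wp; rewrite ltnS big_cons => /(IHk _ _ wp) h.
apply: leq_trans (fold_min_le_mem _ _ (_ : e \in _)) _; first by rewrite mem_enum.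
apply: leq_trans (leq_add (leqnn _) h); rewrite /= geq_min.
case/orP: je => [/eqP->|/andP[/negbTE dG /eqP->]] /=; rewrite eqxx.
  by rewrite /forward_cost eF geq_minr.
by rewrite /backward_cost dG /forward_cost eF geq_minr orbT.
Qed.

End BellmanFord.

(** * Scaled instances *)

Section Scaled.
Variable I : instance.
Variables (Q : nat) (Wn Ln : edge I -> nat) (Dn : 'I_(nK I) -> nat).
Hypothesis Q_gt0 : (0 < Q)%N.
Hypothesis WnE : forall e, (Wn e)%:R = weight e * Q%:R :> rat.
Hypothesis LnE : forall e, (Ln e)%:R = len e * Q%:R :> rat.
Hypothesis DnE : forall i, (Dn i)%:R = demand i * Q%:R :> rat.
Implicit Types (F H : {set edge I}) (e : edge I) (u v : node I).

Let B := (2 ^ nE I)%N.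

Definition cost e := (Ln e * B + 2 ^ e)%N.

(** This exceeds the cost of every path, and its quotient by [B] exceeds every scaled demand and the
    scaled length of every path, so infinite distances compare correctly. As a multiple of [B] it
    carries the empty edge mask. *)
Definition inf := (B * (\sum_e Ln e + \sum_i Dn i + 1))%N.

Definition cdist F u v := best inf (bellman_ford inf cost F v (nE I)) v u.

Definition path_cost (p : steps I) := (\sum_(s <- p) cost s.1)%N.

Lemma B_gt0 : (0 < B)%N. Proof. by rewrite expn_gt0. Qed.

Lemma sum_uniq_edges F u (p : steps I) v (f : edge I -> nat) : is_path F u p v ->
  (\sum_(s <- p) f s.1 = \sum_(e in path_edges p) f e)%N.
Proof.
move=> /path_uniq_edges un; rewrite -(big_map fst predT f) big_uniq //=.
by apply: eq_bigl => e; rewrite inE.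
Qed.

Lemma perturbation_mask F u (p : steps I) v : is_path F u p v ->
  perturbation p = mask (path_edges p).
Proof. exact: sum_uniq_edges. Qed.

Definition path_Ln (p : steps I) := (\sum_(s <- p) Ln s.1)%N.

Lemma path_costE (p : steps I) : path_cost p = (path_Ln p * B + perturbation p)%N.
Proof. by rewrite /path_cost big_split /= -big_distrl. Qed.

Lemma path_LnE (p : steps I) : (path_Ln p)%:R = path_length (@len I) p * Q%:R.
Proof.
rewrite /path_Ln natr_sum /path_length mulr_suml.
by apply: eq_bigr => s _; rewrite LnE.
Qed.

Lemma path_cost_div F u (p : steps I) v : is_path F u p v ->
  (path_cost p %/ B = path_Ln p)%N.
Proof.
move=> pp; rewrite path_costE divnMDl ?B_gt0 // divn_small ?addn0 //.
by rewrite (perturbation_mask pp) mask_lt.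
Qed.

Lemma path_cost_mod F u (p : steps I) v : is_path F u p v ->
  (path_cost p %% B = mask (path_edges p))%N.
Proof.
move=> pp; rewrite path_costE modnMDl modn_small (perturbation_mask pp) //.
exact: mask_lt.
Qed.

Lemma path_cost_lt_inf F u (p : steps I) v : is_path F u p v ->
  (path_cost p < inf)%N.
Proof.
move=> pp; rewrite path_costE (perturbation_mask pp) /inf mulnDr muln1 mulnDr.
have : (path_Ln p <= \sum_e Ln e)%N.
  rewrite /path_Ln (sum_uniq_edges _ pp) big_mkcond /=.
  by apply: leq_sum => e _; case: ifP.
have := mask_lt (path_edges p); rewrite -/B.
move: (mask _) (path_Ln p) (\sum_i Dn i)%N (\sum_e Ln e)%N => a b d c ab bc.
have : (b * B <= B * c)%N by rewrite mulnC leq_mul2l bc orbT.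
by lia.
Qed.

Lemma not_longerE F u (p q : steps I) v : is_path F u p v -> is_path F u q v ->
  not_longer (@len I) p q = (path_cost p <= path_cost q)%N.
Proof.
move=> pp pq; rewrite /not_longer.
have Q0 : 0 < Q%:R :> rat by rewrite ltr0n.
rewrite -(ltr_pM2r Q0) -(inj_eq (mulIf (lt0r_neq0 Q0))) -!path_LnE ltr_nat eqr_nat.
have := mask_lt (path_edges p); have := mask_lt (path_edges q).
rewrite -(perturbation_mask pp) -(perturbation_mask pq) !path_costE -/B.
move: (perturbation p) (perturbation q) (path_Ln p) (path_Ln q) => a b c d bB aB.
have [cd|dc|->] := ltngtP c d; rewrite /= ?leq_add2l //.
  have : (c.+1 * B <= d * B)%N by rewrite leq_mul2r cd orbT.
  by rewrite mulSn; lia.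
have : (d.+1 * B <= c * B)%N by rewrite leq_mul2r dc orbT.
by rewrite mulSn; lia.
Qed.

Lemma cdist_le_inf F u v : (cdist F u v <= inf)%N.
Proof. exact: best_le. Qed.

Lemma cdist_le_path F u (p : steps I) v : is_path F u p v ->
  (cdist F u v <= path_cost p)%N.
Proof.
move=> pp; apply: bellman_ford_complete; first by case/andP: pp.
exact: path_size_edges pp.
Qed.

Lemma cdist_attained F u v : (cdist F u v < inf)%N ->
  exists2 p : steps I, is_path F u p v & (path_cost p <= cdist F u v)%N.
Proof.
move=> /bellman_ford_sound[p /(walk_to_path cost)[q /path_steps[r pr <-] lr] ep].
by exists r; rewrite // /path_cost (leq_trans lr) ?ep.
Qed.

(** One case analysis replaces the computed distance, the shortest path, the rational distance and
    the existence of a path, all in step with each other. *)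
Variant cdist_spec F u v : nat -> option (steps I) -> \bar rat -> bool -> Type :=
| CdistPath (p : steps I) of is_path F u p v :
    cdist_spec F u v (path_cost p) (Some p) (path_length (@len I) p)%:E true
| CdistInf : cdist_spec F u v inf None +oo%E false.

Lemma cdistP F u v : cdist_spec F u v (cdist F u v)
  (shortest_path (@len I) F u v) (dist (@len I) F u v) (connects F u v).
Proof.
have := shortest_pathP (@len I) F u v.
case e : (shortest_path _ _ _ _) => [p|].
  case=> pp min; rewrite (shortest_path_dist e).
  have -> : connects F u v by apply/existsP; exists p.
  suff -> : cdist F u v = path_cost p by constructor.
  apply/eqP; rewrite eqn_leq (cdist_le_path pp) /=.
  have [|q pq] := @cdist_attained F u v.
    exact: leq_ltn_trans (cdist_le_path pp) (path_cost_lt_inf pp).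
  by apply: leq_trans; rewrite -(not_longerE pp pq) min.
move=> nc; rewrite (not_connects_dist (@len I) nc) (negbTE nc).
suff -> : cdist F u v = inf by constructor.
apply/eqP; rewrite eqn_leq cdist_le_inf leqNgt; apply/negP.
by case/cdist_attained=> p pp _; case/negP: nc; apply/existsP; exists p.
Qed.

Lemma inf_div : (inf %/ B = \sum_e Ln e + \sum_i Dn i + 1)%N.
Proof. by rewrite /inf mulKn ?B_gt0. Qed.

Definition sat F (i : 'I_(nK I)) :=
  (cdist F (terminals i).1 (terminals i).2 %/ B <= Dn i)%N.

Lemma satE F i : (tdist F i <= (demand i)%:E)%E = sat F i.
Proof.
rewrite /sat /tdist; case: cdistP => [p pp|].
  rewrite (path_cost_div pp) lee_fin.
  have Q0 : 0 < Q%:R :> rat by rewrite ltr0n.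
  by rewrite -(ler_pM2r Q0) -path_LnE -DnE ler_nat.
rewrite inf_div leNgt ltry /=; apply/esym/negbTE; rewrite -ltnNge.
by rewrite [(\sum_i Dn i)%N](bigD1 i) //=; lia.
Qed.

Lemma feasibleE F : feasible F = [forall i, sat F i].
Proof. by apply: eq_forallb => i; rewrite satE. Qed.

Lemma tdist_le F i j : (tdist F i <= tdist F j)%E =
  (cdist F (terminals i).1 (terminals i).2 %/ B <=
   cdist F (terminals j).1 (terminals j).2 %/ B)%N.
Proof.
have Q0 : 0 < Q%:R :> rat by rewrite ltr0n.
rewrite /tdist; case: cdistP => [p pp|]; case: cdistP => [q pq|].
- rewrite lee_fin (path_cost_div pp) (path_cost_div pq).
  by rewrite -(ler_pM2r Q0) -!path_LnE ler_nat.
- by rewrite leey leq_div2r // ltnW // (path_cost_lt_inf pp).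
- rewrite leNgt ltry /=; apply/esym/negbTE; rewrite -ltnNge.
  rewrite inf_div (path_cost_div pq) /path_Ln (sum_uniq_edges _ pq) big_mkcond /=.
  apply: (@leq_ltn_trans (\sum_e Ln e)); last by rewrite addn1 ltnS leq_addr.
  by apply: leq_sum => e _; case: ifP.
- by rewrite lexx leqnn.
Qed.

Definition set_of_bits (n : nat) : {set edge I} := [set e : edge I | testbit n e].

Lemma mask_set_of_bits F : set_of_bits (mask F) = F.
Proof. by apply/setP=> e; rewrite inE mask_testbit. Qed.

Lemma add_pairE F H i : add_pair F H i = if sat H i then H else
  H :|: set_of_bits (cdist F (terminals i).1 (terminals i).2 %% B).
Proof.
rewrite /add_pair satE; case: (sat H i) => //.
case: cdistP => [p pp|]; first by rewrite (path_cost_mod pp) mask_set_of_bits.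
rewrite /inf modnMr; apply/setP=> e.
by rewrite !inE /testbit div0n orbF.
Qed.

Definition light (w : nat) : {set edge I} := [set e | (Wn e <= w)%N].

Lemma lightE (w : rat) (n : nat) : n%:R = w * Q%:R -> light_edges I w = light n.
Proof.
have Q0 : 0 < Q%:R :> rat by rewrite ltr0n.
by move=> nw; apply/setP=> e; rewrite !inE -(ler_pM2r Q0) -nw -WnE ler_nat.
Qed.

(** All edge weights are tried, in place of a binary search. The total weight is at least every
    single weight, so it serves both as the start of the minimum and as the value of failed
    candidates. *)
Definition threshold_nat :=
  fold_min (fun e => if feasible (light (Wn e)) then Wn e else \sum_e Wn e)%N
    (\sum_e Wn e)%N (enum (edge I)).

Lemma threshold_natE : (exists F : {set edge I}, feasible F) ->
  threshold_nat%:R = threshold I * Q%:R.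
Proof.
case/threshold_spec=> -[e0 te0] ft mint.
have Q0 : 0 < Q%:R :> rat by rewrite ltr0n.
rewrite te0 -WnE; congr _%:R; apply/eqP; rewrite eqn_leq; apply/andP; split.
  apply: leq_trans (fold_min_le_mem _ _ (_ : e0 \in _)) _; first by rewrite mem_enum.
  by rewrite -(lightE (WnE e0)) -te0 ft.
rewrite fold_min_geP; have WS e : (Wn e <= \sum_e Wn e)%N.
  by rewrite (bigD1 e) //= leq_addr.
rewrite WS; apply/allP=> e _; case: ifP => // fe.
by rewrite -(ler_nat rat) !WnE ler_pM2r // -te0 mint // (lightE (WnE e)).
Qed.

Definition weight_cost e := (Wn e * B + 2 ^ e)%N.

(** Weights select the subgraph, while lengths are measured in it: the test only asks whether the
    distance is finite. *)
Definition mst_nat := (\sum_e if cdist (lighter weight_cost e) (ends e).1 (ends e).2 < inf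
                              then 0 else Wn e)%N.

Lemma weight_cost_sum F :
  (\sum_(e in F) weight_cost e = (\sum_(e in F) Wn e) * B + mask F)%N.
Proof. by rewrite big_split /= -big_distrl. Qed.

Lemma weight_cost_inj : injective weight_cost.
Proof.
move=> e f; rewrite /weight_cost => /(congr1 (modn^~ B)).
by rewrite !modnMDl !modn_small ?ltn_exp2l // => /eqP; rewrite eqn_exp2l // => /eqP/val_inj.
Qed.

Lemma mst_natE : ~~ directed I -> mst_nat%:R = MST_weight I * Q%:R.
Proof.
move=> und; have Q0 : 0 < Q%:R :> rat by rewrite ltr0n.
have c0 e : (0 < weight_cost e)%N by rewrite /weight_cost addn_gt0 expn_gt0 orbT.
have [sk mink] := kruskal_min weight_cost_inj c0 (connectedG I).
have -> : mst_nat = (\sum_(e in kruskal weight_cost) Wn e)%N.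
  rewrite [RHS]big_mkcond; apply: eq_bigr => e _; rewrite inE connect_undirected //.
  by case: cdistP => [p /path_cost_lt_inf ->|]; rewrite ?ltnn.
have scaled F : (\sum_(e in F) Wn e)%:R = total_weight F * Q%:R :> rat.
  by rewrite natr_sum mulr_suml; apply: eq_bigr => e _; rewrite WnE.
rewrite scaled; congr (_ * _); apply/eqP; rewrite eq_le; apply/andP; split.
  apply/bigmin_geP; split; first exact/total_weight_sub/subsetT.
  move=> T /andP[/mink + _]; rewrite !weight_cost_sum => leT.
  rewrite -(ler_pM2r Q0) -!scaled ler_nat leqNgt; apply/negP => lt.
  (* An excess of at least 1 in scaled weight amounts to at least [B] in the tie-broken cost, more
     than any mask can make up for. *)
  have h : ((\sum_(e in T) Wn e).+1 * B <= (\sum_(e in kruskal weight_cost) Wn e) * B)%N.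
    by rewrite leq_mul2r lt orbT.
  have := leq_trans h (leq_trans (leq_addr _ _) leT).
  by rewrite mulSn addnC leq_add2l leqNgt mask_lt.
by apply: bigmin_le_cond.
Qed.

End Scaled.

(** * Sorting by ranks *)

Lemma foldl_if (S T : Type) (P : pred T) (f : S -> T -> S) x s :
  foldl (fun y i => if P i then f y i else y) x s = foldl f x [seq i <- s | P i].
Proof. by elim: s x => //= i s IHs x; rewrite IHs; case: (P i). Qed.

Section StableSort.
Variables (k : nat) (key : 'I_k -> nat) (leT : rel 'I_k).
Hypothesis leTE : forall i j, leT i j = (key i <= key j)%N.

(** [sort] is stable and the enumeration is increasing, so elements with equal keys stay in the
    order of their indices. As [i < k], this number compares keys first and indices second. *)
Definition tie_key (i : 'I_k) : nat := (key i * k + i)%N.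

Definition rank (i : 'I_k) : nat := count (fun j => (tie_key j < tie_key i)%N) (enum 'I_k).

Let s := sort leT (enum 'I_k).

Lemma sorted_tie_key : sorted ltn (map tie_key s).
Proof.
rewrite sorted_map.
have /sort_stable h : total leT by move=> i j; rewrite !leTE leq_total.
have se : sorted (fun i j : 'I_k => (i < j)%N) (enum 'I_k).
  by have := iota_ltn_sorted 0 k; rewrite -val_enum_ord sorted_map.
have tr : transitive (fun i j : 'I_k => (i < j)%N) by move=> a b c; apply: ltn_trans.
apply: sub_sorted (h _ tr _ se) => i j /=; rewrite !leTE => /andP[ij /implyP ji].
rewrite /tie_key; case: (ltngtP (key i) (key j)) ij ji => // [lt _ _|-> _ /(_ isT)].
  by have := ltn_ord i; nia.
by rewrite ltn_add2l.
Qed.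

Lemma perm_sort_enum : perm_eq s (enum 'I_k). Proof. by rewrite perm_sort. Qed.

Lemma size_sort_enum : size s = k.
Proof. by rewrite (perm_size perm_sort_enum) size_enum_ord. Qed.

Lemma rank_nth i0 (i : 'I_k) : rank (nth i0 s i) = i.
Proof.
rewrite /rank -(permP perm_sort_enum).
rewrite -(count_map tie_key (fun n => n < tie_key (nth i0 s i))%N).
have := @count_lt_nth _ nat 0%N (map tie_key s) i sorted_tie_key.
by rewrite size_map size_sort_enum (nth_map i0) ?size_sort_enum // => ->.
Qed.

Lemma filter_rank i0 (i : 'I_k) : [seq j <- enum 'I_k | rank j == i] = [:: nth i0 s i].
Proof.
rewrite -(filter_pred1_uniq (enum_uniq 'I_k) (mem_enum _ (nth i0 s i))).
apply: eq_filter => j /=; apply/eqP/eqP => [rj|->]; last exact: rank_nth.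
have js : j \in s by rewrite mem_sort mem_enum.
have jk : (index j s < k)%N by rewrite -[X in (_ < X)%N]size_sort_enum index_mem.
have := rank_nth i0 (Ordinal jk); rewrite /= nth_index // rj => ->.
by rewrite nth_index.
Qed.

(** For each position the inner loop acts on the single element of that rank, so two nested folds
    process the elements in sorted order without ever building a sorted list. *)
Lemma foldl_sort (S : Type) (f : S -> 'I_k -> S) x :
  foldl (fun y (i : 'I_k) => foldl (fun y j => if rank j == i :> nat then f y j else y)
      y (enum 'I_k))
    x (enum 'I_k) = foldl f x s.
Proof.
have [k0|[i0]] : k = 0%N \/ inhabited 'I_k.
  by case: (posnP k) => [->|k0]; [left | right; exists; exact: Ordinal k0].
  have e0 : enum 'I_k = [::] by apply/size0nil; rewrite size_enum_ord.
  by rewrite /s e0.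
have h (t : seq 'I_k) y : foldl (fun y (i : 'I_k) =>
      foldl (fun y j => if rank j == i :> nat then f y j else y) y (enum 'I_k)) y t =
    foldl f y [seq nth i0 s (val i) | i <- t].
  by elim: t y => //= i t IHt y; rewrite foldl_if (filter_rank i0) IHt.
rewrite h; congr (foldl f x _).
rewrite (map_comp (nth i0 s) val) val_enum_ord map_nth_iota0 ?size_sort_enum //.
by rewrite -[X in take X](size_sort_enum) take_size.
Qed.

End StableSort.

(** * Evaluation of programs *)

Lemma foldl_sum (T : Type) (f : T -> nat) (t : seq T) :
  (\sum_(i <- t) f i = foldl (fun x i => x + f i) 0 t)%N.
Proof.
have h x : (x + \sum_(i <- t) f i = foldl (fun x i => x + f i) x t)%N.
  elim: t x => [|i t IHt] x /=; first by rewrite big_nil addn0.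
  by rewrite big_cons addnA IHt.
by rewrite -h.
Qed.

Section Evaluation.
Variable M : nat.

(** [M] bounds the length of every list folded over, and all operands are below [2 ^ M]. Such an
    operand has at most [M.+1] digits, whence the factors [M.+2]. Both branches of a conditional are
    counted. *)
Fixpoint time_bound (e : exp) : nat :=
  match e with
  | Var _ | Cst _ => 1
  | MkPair a b | Let a b => (time_bound a + time_bound b).+1
  | Fst a | Snd a | IsNat a => (time_bound a).+1
  | Op _ a b => time_bound a + time_bound b + M.+2 * M.+2
  | If c a b => (time_bound c + (time_bound a + time_bound b)).+1
  | Fold l a b => (time_bound l + time_bound a + M * (time_bound b).+1).+1
  end%N.

(** Value and time are verified together, so that the rules below give the running time as a
    by-product of correctness. *)
Definition evals (s : seq data) (e : exp) (v : data) : Prop :=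
  (eval s e).1 = v /\ ((eval s e).2 <= time_bound e)%N.

Implicit Types (s : seq data) (a b c e l : exp) (v : data).

Lemma evals_var s i v : nth (Nat 0) s i = v -> evals s (Var i) v.
Proof. by []. Qed.

Lemma evals_cst s n : evals s (Cst n) (Nat n).
Proof. by []. Qed.

Lemma evals_pair s a b va vb :
  evals s a va -> evals s b vb -> evals s (MkPair a b) (Pair va vb).
Proof. by case=> <- la [<- lb]; split=> //=; rewrite ltnS leq_add. Qed.

Lemma evals_fst s a x y : evals s a (Pair x y) -> evals s (Fst a) x.
Proof. by case=> ea la; split; rewrite /= ?ea. Qed.

Lemma evals_snd s a x y : evals s a (Pair x y) -> evals s (Snd a) y.
Proof. by case=> ea la; split; rewrite /= ?ea. Qed.

Lemma bits_le n : (n < 2 ^ M)%N -> (bits n <= M.+1)%N.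
Proof.
rewrite /bits ltnS; case: n => [|n]; first by rewrite trunc_log0.
move=> lt; have := trunc_logP (isT : 1 < 2)%N (isT : 0 < n.+1)%N => h.
by rewrite -(leq_exp2l _ _ (isT : 1 < 2)%N) (leq_trans h) // ltnW.
Qed.

Lemma evals_op s o a b m n r : evals s a (Nat m) -> evals s b (Nat n) ->
  (m < 2 ^ M)%N -> (n < 2 ^ M)%N -> eval_op o m n = r -> evals s (Op o a b) (Nat r).
Proof.
case=> ea la [eb lb] /bits_le bm /bits_le bn <-.
by split; rewrite /= ea eb //= leq_add ?leq_mul // leq_add.
Qed.

Lemma evals_if s c a b (t : bool) v : evals s c (Nat t) ->
  (t -> evals s a v) -> (~~ t -> evals s b v) -> evals s (If c a b) v.
Proof.
case=> ec lc; case: t ec => ec ha hb.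
  have [ea la] := ha isT; split; rewrite /= ec //= ltnS leq_add //.
  exact: leq_trans la (leq_addr _ _).
have [eb lb] := hb isT; split; rewrite /= ec //= ltnS leq_add //.
exact: leq_trans lb (leq_addl _ _).
Qed.

Lemma evals_let s a b va v :
  evals s a va -> evals (va :: s) b v -> evals s (Let a b) v.
Proof.
by case=> ea la [eb lb]; split; rewrite /= ea // ltnS leq_add.
Qed.

Lemma evals_fold (T : eqType) (X : Type) (encT : T -> data) (encX : X -> data)
    (inv : seq T -> X -> Prop) (f : X -> T -> X) s l a b (t : seq T) (x0 : X) :
  evals s l (enc_seq (map encT t)) -> (size t <= M)%N ->
  evals s a (encX x0) -> inv t x0 ->
  (forall i r x, i \in t -> inv (i :: r) x ->
     evals [:: encT i, encX x & s] b (encX (f x i)) /\ inv r (f x i)) ->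
  evals s (Fold l a b) (encX (foldl f x0 t)).
Proof.
case=> el ll st [ea la] i0 hb; rewrite /evals /= el ea.
set g := fun x acc => eval [:: x, acc & s] b.
suff [-> le] : (fold_data g (enc_seq (map encT t)) (encX x0)).1 = encX (foldl f x0 t) /\
    ((fold_data g (enc_seq (map encT t)) (encX x0)).2 <= size t * (time_bound b).+1)%N.
  split=> //; rewrite ltnS leq_add ?leq_add // (leq_trans le) //.
  by rewrite leq_mul2r st orbT.
elim: t x0 i0 hb {el ea la ll st} => [|i t IHt] x0 i0 hb //=.
have [[eb lb] i1] := hb i t x0 (mem_head _ _) i0.
have [|e1 l1] := IHt _ i1.
  by move=> j r x jt; apply: hb; rewrite inE jt orbT.
by rewrite /g eb -/g; split=> //; rewrite mulSn addSn ltnS leq_add.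
Qed.

Lemma evals_foldT (T : eqType) (X : Type) (encT : T -> data) (encX : X -> data)
    (f : X -> T -> X) s l a b (t : seq T) (x0 : X) :
  evals s l (enc_seq (map encT t)) -> (size t <= M)%N ->
  evals s a (encX x0) ->
  (forall i x, i \in t -> evals [:: encT i, encX x & s] b (encX (f x i))) ->
  evals s (Fold l a b) (encX (foldl f x0 t)).
Proof.
move=> h1 h2 h3 h4; apply: (evals_fold (inv := fun _ _ => True)) h1 h2 h3 _ _ => //.
by move=> i r x it _; split=> //; apply: h4.
Qed.

(** As the accumulator never decreases, a bound on the final value covers all intermediate ones. The
    invariant states it for the fold over the rest of the list. *)
Lemma evals_fold_incr (T : eqType) (encT : T -> data) (f : nat -> T -> nat)
    s l a b (t : seq T) x0 :
  evals s l (enc_seq (map encT t)) -> (size t <= M)%N ->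
  evals s a (Nat x0) -> (foldl f x0 t < 2 ^ M)%N ->
  (forall i x, i \in t -> (x <= f x i)%N) ->
  (forall i x, i \in t -> (x < 2 ^ M)%N -> (f x i < 2 ^ M)%N ->
     evals [:: encT i, Nat x & s] b (Nat (f x i))) ->
  evals s (Fold l a b) (Nat (foldl f x0 t)).
Proof.
move=> h1 h2 h3 h4 incr h5.
pose inv (r : seq T) x := {subset r <= t} /\ (foldl f x r < 2 ^ M)%N.
apply: (evals_fold (inv := inv)) h1 h2 h3 _ _; first by split.
move=> i r x it [sr lt].
have st : {subset r <= t} by move=> j jr; apply: sr; rewrite inE jr orbT.
have le y : (y <= foldl f y r)%N.
  elim: r y st {sr lt} => //= j r IHr y st.
  apply: leq_trans (incr j y _) (IHr _ _); first by apply/st/mem_head.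
  by move=> k kr; apply: st; rewrite inE kr orbT.
have fx : (f x i < 2 ^ M)%N by apply: leq_ltn_trans (le _) lt.
by split; [apply: h5 => //; apply: leq_ltn_trans (incr i x it) fx | split].
Qed.

Definition get k i := Fst (iter k Snd (Var i)).

Lemma evals_get s k i (r : seq data) v : nth (Nat 0) s i = enc_seq r ->
  (k < size r)%N -> nth (Nat 0) r k = v -> evals s (get k i) v.
Proof.
move=> ei kr ev.
suff h j : (j <= size r)%N -> evals s (iter j Snd (Var i)) (enc_seq (drop j r)).
  apply: (@evals_fst _ _ _ (enc_seq (drop k.+1 r))).
  have := h k (ltnW kr); rewrite (drop_nth (Nat 0) kr) ev; exact.
elim: j => [|j IHj] jr; first by rewrite drop0; apply: evals_var.
apply: (@evals_snd _ _ (nth (Nat 0) r j)).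
by have := IHj (ltnW jr); rewrite (drop_nth (Nat 0) jr).
Qed.

Definition rev_exp l := Fold l (Cst 0) (MkPair (Var 0) (Var 1)).

Lemma evals_rev (T : eqType) (encT : T -> data) s l (t : seq T) : (size t <= M)%N ->
  evals s l (enc_seq (map encT t)) -> evals s (rev_exp l) (enc_seq (map encT (rev t))).
Proof.
move=> tM el; have -> : rev t = foldl (fun acc x => x :: acc) [::] t.
  by rewrite /rev; elim: t [::] {tM el} => //= x t IHt acc; rewrite IHt.
apply: (evals_foldT (encX := fun r => enc_seq (map encT r))) el tM _ _ => //.
Qed.

(* A fold builds lists in reverse. *)
Definition map_exp l b := Fold (rev_exp l) (Cst 0) (MkPair b (Var 1)).

Lemma evals_map (T : eqType) (encT g : T -> data) s l b (t : seq T) :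
  (size t <= M)%N -> evals s l (enc_seq (map encT t)) ->
  (forall i acc, i \in t -> evals [:: encT i, acc & s] b (g i)) ->
  evals s (map_exp l b) (enc_seq (map g t)).
Proof.
move=> tM /(evals_rev tM) el hb.
have -> : enc_seq (map g t) = foldl (fun acc x => Pair (g x) acc) (Nat 0) (rev t).
  by rewrite foldl_rev; elim: t {tM el hb} => //= x t ->.
apply: (evals_foldT (encX := id)) el _ _ _ => //; first by rewrite size_rev.
move=> i x; rewrite mem_rev => it; apply: evals_pair; last exact: evals_var.
exact: hb.
Qed.

Definition eq_exp a b := If (Op Leq a b) (Op Leq b a) (Cst 0).

Lemma evals_eq s a b m n : evals s a (Nat m) -> evals s b (Nat n) ->
  (m < 2 ^ M)%N -> (n < 2 ^ M)%N -> evals s (eq_exp a b) (Nat (m == n)).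
Proof.
move=> ea eb mM nM; rewrite eqn_leq.
apply: (evals_if (t := (m <= n)%N)); first exact: evals_op ea eb mM nM _.
  by move=> ->; apply: evals_op eb ea nM mM _.
by move=> /negbTE->; apply: evals_cst.
Qed.

Definition min_exp a b := If (Op Leq a b) a b.

Lemma evals_min s a b m n : evals s a (Nat m) -> evals s b (Nat n) ->
  (m < 2 ^ M)%N -> (n < 2 ^ M)%N -> evals s (min_exp a b) (Nat (minn m n)).
Proof.
move=> ea eb mM nM; apply: (evals_if (t := (m <= n)%N)).
- exact: evals_op ea eb mM nM _.
- by move=> /minn_idPl->.
- by rewrite -ltnNge => /ltnW/minn_idPr->.
Qed.

Definition not_exp a := If a (Cst 0) (Cst 1).

Lemma evals_not s a (t : bool) : evals s a (Nat t) -> evals s (not_exp a) (Nat (~~ t)).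
Proof. by move=> ea; apply: (evals_if ea); case: t {ea} => // _; apply: evals_cst. Qed.

Definition mod_exp a b := Op Defs.Sub a (Op Mul (Op Div a b) b).

Lemma evals_mod s a b m n : evals s a (Nat m) -> evals s b (Nat n) ->
  (m < 2 ^ M)%N -> (n < 2 ^ M)%N -> evals s (mod_exp a b) (Nat (m %% n)).
Proof.
move=> ea eb mM nM.
apply: (evals_op (n := (m %/ n * n)%N) ea _ mM).
- apply: (evals_op (m := (m %/ n)%N) _ eb _ nM) => //.
  + exact: evals_op ea eb mM nM _.
  + exact: leq_ltn_trans (leq_div _ _) mM.
- exact: leq_ltn_trans (leq_divM _ _) mM.
- by rewrite /= {1}(divn_eq m n) addKn.
Qed.

Definition bit_exp a p := mod_exp (Op Div a p) (Cst 2).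

Lemma evals_bit s a p n i : evals s a (Nat n) -> evals s p (Nat (2 ^ i)) ->
  (n < 2 ^ M)%N -> (2 ^ i < 2 ^ M)%N -> (2 < 2 ^ M)%N ->
  evals s (bit_exp a p) (Nat (testbit n i)).
Proof.
move=> ea ep nM iM M2; rewrite /testbit -modn2.
apply: evals_mod => //; last exact: leq_ltn_trans (leq_div _ _) nM.
  exact: evals_op ea ep nM iM _.
Qed.

Definition set_exp l cond p := Fold l (Cst 0) (Op Add (Var 1) (If cond p (Cst 0))).

Lemma evals_sum (T : eqType) (encT : T -> data) (f : T -> nat) s l p (t : seq T) :
  evals s l (enc_seq (map encT t)) -> (size t <= M)%N ->
  (\sum_(i <- t) f i < 2 ^ M)%N ->
  (forall i x, i \in t -> evals [:: encT i, x & s] p (Nat (f i))) ->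
  evals s (Fold l (Cst 0) (Op Add (Var 1) p)) (Nat (\sum_(i <- t) f i)%N).
Proof.
move=> el tM; rewrite foldl_sum => lt hp.
apply: (evals_fold_incr el tM) lt _ _ => //; first by move=> i x _; apply: leq_addr.
move=> i x it xM fM; apply: (evals_op (m := x)) (hp i (Nat x) it) xM _ _ => //.
exact: leq_ltn_trans (leq_addl _ _) fM.
Qed.

Lemma evals_set m (encE : 'I_m -> data) (A : {set 'I_m}) s l cond p :
  (m <= M)%N ->
  evals s l (enc_seq (map encE (enum 'I_m))) ->
  (forall (e : 'I_m) acc, evals [:: encE e, acc & s] cond (Nat (e \in A))) ->
  (forall (e : 'I_m) acc, evals [:: encE e, acc & s] p (Nat (2 ^ e))) ->
  evals s (set_exp l cond p) (Nat (mask A)).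
Proof.
move=> mM el hc hp.
have -> : mask A = (\sum_(e <- enum 'I_m) if e \in A then 2 ^ e else 0)%N.
  by rewrite /mask big_mkcond big_enum.
apply: (evals_sum el); first by rewrite size_enum_ord.
  rewrite -big_mkcond big_enum_cond /=; apply: leq_trans (mask_lt A) _.
  by rewrite leq_exp2l.
move=> e x _; apply: (evals_if (hc e x)) => [->|/negbTE->]; first exact: hp.
exact: evals_cst.
Qed.

End Evaluation.

Ltac ev_get := solve [apply: evals_get;
  [solve [eassumption | reflexivity] | reflexivity | reflexivity]].

(** * Subroutines *)

(* The arguments of a subroutine are indices of variables: ic for the context
   (see [context] below), im for a bit mask, iu and iv for nodes, ie and it for
   the records of an edge and of a terminal pair. The comments show the
   environment, from variable 0 on, at each change; s is the environment of the
   subroutine. *)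

Definition best_exp (iD iv iz ii : nat) : exp :=
  Fold (Var iD) (If (eq_exp (Var iz) (Var iv)) (Cst 0) (Var ii))
    (min_exp (Var 1)
       (min_exp (If (eq_exp (get 0 0) (Var iz.+2)) (get 4 0) (Var ii.+2))
                (If (eq_exp (get 1 0) (Var iz.+2)) (get 5 0) (Var ii.+2)))).

Definition record := foldr MkPair (Cst 0).

Definition dist_exp (ic im iu iv : nat) : exp :=
  Let (get 0 ic) (* inf :: s *)
  (Let (map_exp (get 3 ic.+1) (* e :: acc :: inf :: s *)
     (Let (If (bit_exp (Var im.+3) (get 4 0))
              (Op Add (Op Mul (get 3 0) (get 1 ic.+3)) (get 4 0)) (Var 2))
      (* c :: e :: acc :: inf :: s *)
      (record [:: get 0 1; get 1 1; Var 0; If (get 2 ic.+4) (Var 3) (Var 0);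
                  Var 3; Var 3])))
  (* D0 :: inf :: s *)
  (Let (Fold (get 3 ic.+2) (Var 0)
     (* e :: D :: D0 :: inf :: s *)
     (map_exp (Var 1)
       (* r :: acc :: e :: D :: D0 :: inf :: s *)
       (Let (get 0 0) (Let (get 1 1)
       (* y :: x :: r :: acc :: e :: D :: D0 :: inf :: s *)
        (record [:: Var 1; Var 0; get 2 2; get 3 2;
           min_exp (Var 7) (Op Add (get 2 2) (best_exp 5 (iv + 8) 0 7));
           min_exp (Var 7) (Op Add (get 3 2) (best_exp 5 (iv + 8) 1 7))])))))
  (* D :: D0 :: inf :: s *)
  (best_exp 0 iv.+3 iu.+3 2))).

Definition sat_exp (ic im it : nat) : exp :=
  Let (get 0 it) (Let (get 1 it.+1)
  (Op Leq (Op Div (dist_exp ic.+2 im.+2 1 0) (get 1 ic.+2)) (get 2 it.+2))).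

Definition feasible_exp (ic im : nat) : exp :=
  Fold (get 4 ic) (Cst 1) (If (Var 1) (sat_exp ic.+2 im.+2 0) (Cst 0)).

Definition light_exp (ic iw : nat) : exp :=
  set_exp (get 3 ic) (Op Leq (get 2 0) (Var iw.+2)) (get 4 0).

Definition weight_cost_exp (ic ie : nat) : exp :=
  Op Add (Op Mul (get 2 ie) (get 1 ic)) (get 4 ie).

Definition lighter_exp (ic ie : nat) : exp :=
  set_exp (get 3 ic)
    (not_exp (Op Leq (weight_cost_exp ic.+2 ie.+2) (weight_cost_exp ic.+2 0)))
    (get 4 0).

Definition total_exp (ic : nat) : exp :=
  Fold (get 3 ic) (Cst 0) (Op Add (Var 1) (get 2 0)).

Definition threshold_exp (ic : nat) : exp :=
  Let (total_exp ic)
  (Fold (get 3 ic.+1) (Var 0)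
    (* e :: a :: total :: s *)
    (Let (get 2 0) (Let (light_exp ic.+4 0)
    (* mask :: w :: e :: a :: total :: s *)
    (Let (If (feasible_exp (ic + 5) 0) (Var 1) (Var 4))
      (min_exp (Var 4) (Var 0)))))).

Definition mst_exp (ic : nat) : exp :=
  Fold (get 3 ic) (Cst 0)
    (* e :: a :: s *)
    (Op Add (Var 1)
    (Let (lighter_exp ic.+2 0) (Let (get 0 1) (Let (get 1 2)
    (* y :: x :: mask :: e :: a :: s *)
    (If (Op Leq (get 0 (ic + 5)) (dist_exp (ic + 5) 2 1 0)) (get 2 3) (Cst 0)))))).

Definition add_pair_exp (ic im ih it : nat) : exp :=
  If (sat_exp ic ih it) (Var ih)
  (Let (get 0 it) (Let (get 1 it.+1)
  (Let (mod_exp (dist_exp ic.+2 im.+2 1 0) (get 1 ic.+2))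
  (* path :: v :: u :: s *)
  (set_exp (get 3 ic.+3)
     (If (bit_exp (Var (5 + ih)) (get 4 0)) (Cst 1) (bit_exp (Var 2) (get 4 0)))
     (get 4 0))))).

Definition rank_exp (il it : nat) : exp :=
  Fold (Var il) (Cst 0)
    (Op Add (Var 1) (not_exp (Op Leq (get 1 it.+2) (get 1 0)))).

Definition greedy_exp (ic im : nat) : exp :=
  Let (map_exp (get 4 ic)
    (* t :: acc :: s *)
    (Let (get 0 0) (Let (get 1 1)
    (record [:: Var 2;
       Op Add (Op Mul (Op Div (dist_exp ic.+4 im.+4 1 0) (get 1 ic.+4)) (get 5 ic.+4))
          (get 3 2);
       get 3 2]))))
  (* T :: s *)
  (Fold (Var 0) (Cst 0) (Fold (Var 2) (Var 1)
    (* t :: H :: t0 :: H0 :: T :: s *)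
    (If (eq_exp (rank_exp 4 0) (get 2 2))
       (Let (get 0 0) (add_pair_exp (ic + 6) (im + 6) 2 0))
       (Var 1)))).

Definition output_exp (ic im : nat) : exp :=
  Fold (rev_exp (get 3 ic)) (Cst 0)
    (If (bit_exp (Var im.+2) (get 4 0)) (MkPair (get 5 0) (Var 1)) (Var 1)).

Section Subroutines.
Variable I : instance.
Variables (Wn Ln : edge I -> nat) (Dn : 'I_(nK I) -> nat).
Variables (M Z : nat).
Local Notation B := (2 ^ nE I)%N.
Local Notation infty := (inf Ln Dn).
Local Notation cdist := (cdist Ln Dn).
Local Notation feas := (fun F : {set edge I} => [forall i, sat Ln Dn F i]).
Hypothesis Z_gt1 : (1 < Z)%N.
Hypothesis ZM : (Z * Z + Z < 2 ^ M)%N.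
Hypothesis inf_leZ : (infty <= Z)%N.
Hypothesis W_leZ : (\sum_e Wn e <= Z)%N.
Hypothesis nV_leZ : (nV I <= Z)%N.
Hypothesis nK_leZ : (nK I <= Z)%N.
Hypothesis nE_leM : (nE I <= M)%N.
Hypothesis nK_leM : (nK I <= M)%N.

(** Stored values are at most [Z], and intermediate ones leave this range by no more than one
    multiplication followed by an addition. This is what [ZM] provides for. *)
Lemma small3 a b c : (a <= Z)%N -> (b <= Z)%N -> (c <= Z)%N ->
  (a * b + c < 2 ^ M)%N.
Proof. by move=> aZ bZ cZ; apply: leq_ltn_trans ZM; rewrite leq_add ?leq_mul. Qed.

Lemma small2 a b : (a <= Z)%N -> (b <= Z)%N -> (a + b < 2 ^ M)%N.
Proof. by move=> aZ bZ; rewrite -[a]muln1; apply: small3 => //; apply: ltnW. Qed.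

Lemma small a : (a <= Z)%N -> (a < 2 ^ M)%N.
Proof. by move=> aZ; rewrite -[a]addn0; apply: small2. Qed.

Lemma node_small (x : node I) : (x < 2 ^ M)%N.
Proof. by apply: small; apply: leq_trans (ltnW (ltn_ord x)) nV_leZ. Qed.

Lemma B_le_inf : (B <= infty)%N.
Proof. by rewrite /inf leq_pmulr // addn1. Qed.

Lemma B_leZ : (B <= Z)%N. Proof. exact: leq_trans B_le_inf inf_leZ. Qed.

Lemma pow_leB (e : edge I) : (2 ^ e <= B)%N.
Proof. by rewrite leq_exp2l // ltnW. Qed.

Lemma pow_leZ (e : edge I) : (2 ^ e <= Z)%N.
Proof. exact: leq_trans (pow_leB e) B_leZ. Qed.

Lemma W_le e : (Wn e <= Z)%N.
Proof. by apply: leq_trans W_leZ; rewrite (bigD1 e) //= leq_addr. Qed.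

Lemma sums_le_inf : (\sum_e Ln e + \sum_i Dn i <= infty)%N.
Proof.
have B0 : (0 < B)%N by rewrite expn_gt0.
by rewrite /inf (leq_trans _ (leq_pmull _ B0)) ?leq_addr.
Qed.

Lemma L_le e : (Ln e <= Z)%N.
Proof.
apply: leq_trans inf_leZ; apply: leq_trans sums_le_inf.
by rewrite (bigD1 e) //= -!addnA leq_addr.
Qed.

Lemma D_le i : (Dn i <= Z)%N.
Proof.
apply: leq_trans inf_leZ; apply: leq_trans sums_le_inf.
by rewrite addnC (bigD1 i) //= -!addnA leq_addr.
Qed.

Lemma cost_le e : (cost Ln e < infty)%N.
Proof.
rewrite /cost /inf mulnDr muln1 mulnC -addnS leq_add //; last by rewrite ltn_exp2l.
by rewrite leq_mul2l (bigD1 e) //= -!addnA leq_addr orbT.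
Qed.

Lemma cdist_leZ F u v : (cdist F u v <= Z)%N.
Proof. exact: leq_trans (best_le _ _ _ _) inf_leZ. Qed.

Lemma set_le (A : {set edge I}) : (mask A < 2 ^ M)%N.
Proof. by apply: small; apply: leq_trans B_leZ; apply/ltnW/mask_lt. Qed.

Definition enc_edge (e : edge I) : data :=
  enc_seq [:: Nat (ends e).1; Nat (ends e).2; Nat (Wn e); Nat (Ln e); Nat (2 ^ e); Nat e].

Definition enc_term (i : 'I_(nK I)) : data :=
  enc_seq [:: Nat (terminals i).1; Nat (terminals i).2; Nat (Dn i); Nat i].

Definition context : data :=
  enc_seq [:: Nat infty; Nat B; Nat (directed I);
              enc_seq (map enc_edge (enum (edge I)));
              enc_seq (map enc_term (enum 'I_(nK I))); Nat (nK I)].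

(** One record per edge: its ends, the costs of the two traversals, which already reflect [F] and
    the orientation, and the two labels. Only the labels change from round to round. *)
Definition enc_dist F (D : edge I -> nat * nat) (e : edge I) : data :=
  enc_seq [:: Nat (ends e).1; Nat (ends e).2;
              Nat (forward_cost infty (cost Ln) F e);
              Nat (backward_cost infty (cost Ln) F e); Nat (D e).1; Nat (D e).2].

Local Notation ev := (evals M).

Lemma size_enum_edge : (size (enum (edge I)) <= M)%N.
Proof. by rewrite size_enum_ord. Qed.

Lemma size_enum_term : (size (enum 'I_(nK I)) <= M)%N.
Proof. by rewrite size_enum_ord. Qed.

Lemma evals_best s iD iv iz ii F D (v z : node I) :
  nth (Nat 0) s iD = enc_seq (map (enc_dist F D) (enum (edge I))) ->
  nth (Nat 0) s iv = Nat v -> nth (Nat 0) s iz = Nat z ->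
  nth (Nat 0) s ii = Nat infty ->
  (forall e, (D e).1 <= infty /\ (D e).2 <= infty)%N ->
  ev s (best_exp iD iv iz ii) (Nat (best infty D v z)).
Proof.
move=> hD hv hz hi hle; have infs := small inf_leZ.
apply: (evals_fold (encX := Nat) (inv := fun _ a => a <= infty)%N) (evals_var _ hD)
  size_enum_edge _ _ _.
- apply: (@evals_if _ _ _ _ _ (z == v)).
  + by apply: evals_eq (evals_var _ hz) (evals_var _ hv) _ _; apply: node_small.
  + by move=> ->; apply: evals_cst.
  + by move/negbTE->; apply: evals_var.
- by case: ifP.
move=> e r a _ ale; have [le1 le2] := hle e.
have case1 (t : bool) d : (d <= infty)%N -> ((if t then d else infty) <= infty)%N by case: t.
split; last by rewrite geq_min ale.
apply: evals_min; first exact: evals_var.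
- apply: evals_min.
  + apply: (@evals_if _ _ _ _ _ ((ends e).1 == z)).
    * by apply: evals_eq (evals_var _ _) _ _; try ev_get; try exact: node_small.
    * by move=> ->; ev_get.
    * by move/negbTE->; apply: evals_var.
  + apply: (@evals_if _ _ _ _ _ ((ends e).2 == z)).
    * by apply: evals_eq; try ev_get; try exact: node_small; apply: evals_var.
    * by move=> ->; ev_get.
    * by move/negbTE->; apply: evals_var.
  + exact: leq_ltn_trans (case1 _ _ _) infs.
  + exact: leq_ltn_trans (case1 _ _ _) infs.
- exact: leq_ltn_trans ale infs.
- by apply: leq_ltn_trans infs; rewrite geq_min case1.
Qed.

(** The edge list serves as a loop counter: one round per edge. *)
Lemma bellman_ford_foldl F v :
  bellman_ford infty (cost Ln) F v (nE I) =
  foldl (fun D _ => relax infty (cost Ln) F v D) (fun=> (infty, infty)) (enum (edge I)).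
Proof.
have h (t : seq (edge I)) D : foldl (fun D _ => relax infty (cost Ln) F v D) D t =
    iter (size t) (relax infty (cost Ln) F v) D.
  by elim: t D => //= _ t IHt D; rewrite IHt -iterSr.
by rewrite h size_enum_ord.
Qed.

Lemma forward_cost_le F e : (forward_cost infty (cost Ln) F e <= infty)%N.
Proof. by rewrite /forward_cost; case: ifP => // _; apply/ltnW/cost_le. Qed.

Lemma backward_cost_le F e : (backward_cost infty (cost Ln) F e <= infty)%N.
Proof. by rewrite /backward_cost; case: ifP => // _; apply: forward_cost_le. Qed.

Lemma evals_dist s ic im iu iv F (u v : node I) :
  nth (Nat 0) s ic = context -> nth (Nat 0) s im = Nat (mask F) ->
  nth (Nat 0) s iu = Nat u -> nth (Nat 0) s iv = Nat v ->
  ev s (dist_exp ic im iu iv) (Nat (cdist F u v)).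
Proof.
move=> hc hm hu hv; have infs := small inf_leZ.
have s2 : (2 < 2 ^ M)%N by apply: small.
apply: evals_let; first by ev_get.
apply: (@evals_let _ _ _ _
    (enc_seq (map (enc_dist F (fun=> (infty, infty))) (enum (edge I))))).
  apply: (@evals_map _ _ enc_edge) size_enum_edge _ _; first by ev_get.
  move=> e acc _; apply: (@evals_let _ _ _ _ (Nat (forward_cost infty (cost Ln) F e))).
    rewrite /forward_cost; apply: (@evals_if _ _ _ _ _ (e \in F)).
    - rewrite -mask_testbit; apply: evals_bit => //; try ev_get; try exact: evals_var.
      + exact: set_le.
      + exact/small/pow_leZ.
    - move=> ->; apply: (@evals_op _ _ _ _ _ (Ln e * B) (2 ^ e)).
      + apply: (@evals_op _ _ _ _ _ (Ln e) B) => //; try ev_get.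
          exact/small/L_le.
        exact/small/B_leZ.
      + by ev_get.
      + by rewrite -[(_ * _)%N]addn0 small3 ?L_le ?B_leZ.
      + exact/small/pow_leZ.
      + by [].
    - by move/negbTE->; apply: evals_var.
  do 6?[apply: evals_pair]; try ev_get; try exact: evals_var; try exact: evals_cst.
  rewrite /backward_cost; apply: (@evals_if _ _ _ _ _ (directed I)); first by ev_get.
    by move=> ->; apply: evals_var.
  by move/negbTE->; apply: evals_var.
apply: (@evals_let _ _ _ _ (enc_seq (map (enc_dist F
    (bellman_ford infty (cost Ln) F v (nE I))) (enum (edge I))))); last first.
  apply: (evals_best (F := F)) => //; last exact: bellman_ford_le.
rewrite bellman_ford_foldl.
apply: (evals_fold (encT := enc_edge)
  (encX := fun D => enc_seq (map (enc_dist F D) (enum (edge I))))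
  (inv := fun _ D => forall e, ((D e).1 <= infty /\ (D e).2 <= infty)%N))
  _ size_enum_edge _ _ _.
- by ev_get.
- exact: evals_var.
- by [].
move=> e0 r0 D _ hD; split; last by move=> f; rewrite !geq_minl.
apply: (@evals_map _ _ (enc_dist F D)) size_enum_edge _ _; first exact: evals_var.
move=> e acc _; apply: evals_let; first by ev_get.
apply: evals_let; first by ev_get.
do 6?[apply: evals_pair]; try ev_get; try exact: evals_var; try exact: evals_cst.
- apply: (@evals_min _ _ _ _ infty (forward_cost infty (cost Ln) F e +
    best infty D v (ends e).2)) => //.
  + apply: (evals_op (m := forward_cost infty (cost Ln) F e)
      (n := best infty D v (ends e).2)) => //.
    * apply: (evals_best (F := F)) => //; first by rewrite addnC.
    * exact: leq_ltn_trans (forward_cost_le _ _) infs.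
    * exact: leq_ltn_trans (best_le _ _ _ _) infs.
  + apply: small2; first exact: leq_trans (forward_cost_le _ _) inf_leZ.
    exact: leq_trans (best_le _ _ _ _) inf_leZ.
- apply: (@evals_min _ _ _ _ infty (backward_cost infty (cost Ln) F e +
    best infty D v (ends e).1)) => //.
  + apply: (evals_op (m := backward_cost infty (cost Ln) F e)
      (n := best infty D v (ends e).1)) => //.
    * apply: (evals_best (F := F)) => //; first by rewrite addnC.
    * exact: leq_ltn_trans (backward_cost_le _ _) infs.
    * exact: leq_ltn_trans (best_le _ _ _ _) infs.
  + apply: small2; first exact: leq_trans (backward_cost_le _ _) inf_leZ.
    exact: leq_trans (best_le _ _ _ _) inf_leZ.
Qed.

Lemma evals_sat s ic im it F (i : 'I_(nK I)) :
  nth (Nat 0) s ic = context -> nth (Nat 0) s im = Nat (mask F) ->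
  nth (Nat 0) s it = enc_term i -> ev s (sat_exp ic im it) (Nat (sat Ln Dn F i)).
Proof.
move=> hc hm hi; apply: evals_let; first by ev_get.
apply: evals_let; first by ev_get.
apply: (@evals_op _ _ _ _ _ (cdist F (terminals i).1 (terminals i).2 %/ B) (Dn i)).
- apply: evals_op; [exact: (evals_dist (F := F)) | by ev_get | | | reflexivity].
    exact/small/cdist_leZ.
  exact/small/B_leZ.
- by ev_get.
- apply: leq_ltn_trans (leq_div _ _) _; exact/small/cdist_leZ.
- exact/small/D_le.
- by [].
Qed.

Lemma evals_feasible s ic im F :
  nth (Nat 0) s ic = context -> nth (Nat 0) s im = Nat (mask F) ->
  ev s (feasible_exp ic im) (Nat (feas F)).
Proof.
move=> hc hm.
have -> : feas F = foldl (fun b i => b && sat Ln Dn F i) true (enum 'I_(nK I)).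
  have h t b : foldl (fun b i => b && sat Ln Dn F i) b t = b && all (sat Ln Dn F) t.
    by elim: t b => [|i t IHt] b /=; rewrite ?andbT // IHt andbA.
  rewrite h /=; apply/forallP/allP => [h' i _|h' i]; apply: h' => //.
  by rewrite mem_enum.
apply: (evals_foldT (encT := enc_term) (encX := fun b : bool => Nat b)) _ size_enum_term _ _.
- by ev_get.
- exact: evals_cst.
move=> i b _; apply: (evals_if (t := b)); first exact: evals_var.
  by move=> ->; apply: evals_sat.
by move/negbTE->; apply: evals_cst.
Qed.

Lemma evals_light s ic iw (w : nat) : (w <= Z)%N ->
  nth (Nat 0) s ic = context -> nth (Nat 0) s iw = Nat w ->
  ev s (light_exp ic iw) (Nat (mask (light Wn w))).
Proof.
move=> wZ hc hw; apply: (evals_set (encE := enc_edge)) => //; first by ev_get.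
- move=> e acc; rewrite inE; apply: (evals_op (m := Wn e) (n := w)) => //.
  + exact/small/W_le.
  + exact: small.
Qed.

Lemma evals_weight_cost s ic ie (e : edge I) :
  nth (Nat 0) s ic = context -> nth (Nat 0) s ie = enc_edge e ->
  ev s (weight_cost_exp ic ie) (Nat (weight_cost Wn e)).
Proof.
move=> hc he; apply: (evals_op (m := (Wn e * B)%N) (n := (2 ^ e)%N)) => //.
- apply: (evals_op (m := Wn e) (n := B)); try ev_get; try by [].
    exact/small/W_le.
  exact/small/B_leZ.
- by ev_get.
- by rewrite -[(_ * _)%N]addn0 small3 ?W_le ?B_leZ.
- exact/small/pow_leZ.
Qed.

Lemma evals_lighter s ic ie (e : edge I) :
  nth (Nat 0) s ic = context -> nth (Nat 0) s ie = enc_edge e ->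
  ev s (lighter_exp ic ie) (Nat (mask (lighter (weight_cost Wn) e))).
Proof.
move=> hc he; apply: (evals_set (encE := enc_edge)) => //; first by ev_get.
- move=> f acc; rewrite inE ltnNge; apply: evals_not.
  apply: (evals_op (m := weight_cost Wn e) (n := weight_cost Wn f)) => //.
  + exact: evals_weight_cost.
  + exact: evals_weight_cost.
  + by apply: small3; rewrite ?W_le ?B_leZ ?pow_leZ.
  + by apply: small3; rewrite ?W_le ?B_leZ ?pow_leZ.
Qed.

Lemma evals_total s ic : nth (Nat 0) s ic = context ->
  ev s (total_exp ic) (Nat (\sum_e Wn e)).
Proof.
move=> hc; rewrite -big_enum.
apply: (evals_sum (encT := enc_edge)) _ size_enum_edge _ _.
- by ev_get.
- by rewrite big_enum; apply: small.
- by move=> e x _; ev_get.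
Qed.

Lemma evals_threshold s ic : nth (Nat 0) s ic = context ->
  ev s (threshold_exp ic) (Nat (fold_min
    (fun e => if feas (light Wn (Wn e)) then Wn e else \sum_e Wn e)%N
    (\sum_e Wn e)%N (enum (edge I)))).
Proof.
move=> hc; apply: evals_let; first exact: evals_total.
apply: (evals_fold (encT := enc_edge) (encX := Nat)
  (inv := fun _ a => a <= Z)%N) _ size_enum_edge _ _ _.
- by ev_get.
- exact: evals_var.
- exact: W_leZ.
move=> e r a _ aZ; split; last by rewrite geq_min aZ.
apply: evals_let; first by ev_get.
apply: evals_let; first by apply: evals_light (W_le e) _ _ => //.
apply: (@evals_let _ _ _ _
    (Nat (if feas (light Wn (Wn e)) then Wn e else \sum_e Wn e)%N)).
  apply: evals_if; first by apply: evals_feasible => //; rewrite addnC.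
    by move=> ->; apply: evals_var.
  by move/negbTE->; apply: evals_var.
apply: evals_min; try exact: evals_var; first exact: small.
by case: ifP => _; apply: small => //; apply: W_le.
Qed.

Lemma evals_mst s ic : nth (Nat 0) s ic = context ->
  ev s (mst_exp ic) (Nat (mst_nat Wn Ln Dn)).
Proof.
move=> hc; rewrite /mst_nat -big_enum.
apply: (evals_sum (encT := enc_edge)) _ size_enum_edge _ _.
- by ev_get.
- rewrite big_enum /=; apply: small; apply: leq_trans W_leZ.
  by apply: leq_sum => e _; case: ifP.
move=> e x _; apply: evals_let; first by apply: (evals_lighter (e := e)).
apply: evals_let; first by ev_get.
apply: evals_let; first by ev_get.
set d := cdist _ _ _; apply: (evals_if (t := (infty <= d)%N)).
- apply: (evals_op (m := infty) (n := d)) => //.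
  + by rewrite addnC; ev_get.
  + by apply: (evals_dist (F := lighter (weight_cost Wn) e)); rewrite // addnC.
  + exact: small.
  + exact/small/cdist_leZ.
- by rewrite leqNgt => /negbTE->; ev_get.
- by rewrite -ltnNge => ->; apply: evals_cst.
Qed.

(** The right side of [add_pairE], restated because nothing in this section relates the natural
    numbers to the rational data. *)
Definition add_pair_bits F (H : {set edge I}) (i : 'I_(nK I)) : {set edge I} :=
  if sat Ln Dn H i then H else
  H :|: set_of_bits I (cdist F (terminals i).1 (terminals i).2 %% B).

Lemma evals_add_pair s ic im ih it F (H : {set edge I}) (i : 'I_(nK I)) :
  nth (Nat 0) s ic = context -> nth (Nat 0) s im = Nat (mask F) ->
  nth (Nat 0) s ih = Nat (mask H) -> nth (Nat 0) s it = enc_term i ->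
  ev s (add_pair_exp ic im ih it) (Nat (mask (add_pair_bits F H i))).
Proof.
move=> hc hm hh hi; have s2 : (2 < 2 ^ M)%N by apply: small.
apply: (evals_if (t := sat Ln Dn H i)).
  exact: evals_sat hc hh hi.
  by rewrite /add_pair_bits => ->; apply: evals_var.
rewrite /add_pair_bits => /negbTE->.
apply: evals_let; first by ev_get.
apply: evals_let; first by ev_get.
set d := cdist _ _ _; have dM : (d < 2 ^ M)%N by apply/small/cdist_leZ.
apply: (@evals_let _ _ _ _ (Nat (d %% B))).
  apply: evals_mod => //; last exact/small/B_leZ.
    exact: (evals_dist (F := F)).
  by ev_get.
apply: (evals_set (encE := enc_edge)) => //; first by ev_get.
move=> e acc; rewrite !inE; apply: (evals_if (t := e \in H)).
- rewrite -mask_testbit; apply: evals_bit => //; [exact: set_le | exact/small/pow_leZ].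
- by move=> ->; apply: evals_cst.
move/negbTE->; rewrite orFb; apply: evals_bit => //; last exact/small/pow_leZ.
exact: leq_ltn_trans (leq_mod _ _) dM.
Qed.

Definition dist_key F (i : 'I_(nK I)) : nat :=
  (cdist F (terminals i).1 (terminals i).2 %/ B)%N.

(** The keys are attached to the pairs once, so that ranks are counted without recomputing
    distances. *)
Definition enc_key F (i : 'I_(nK I)) : data :=
  enc_seq [:: enc_term i; Nat (tie_key (dist_key F) i); Nat i].

Lemma dist_key_leZ F i : (dist_key F i <= Z)%N.
Proof. exact: leq_trans (leq_div _ _) (cdist_leZ _ _ _). Qed.

Lemma term_leZ (i : 'I_(nK I)) : (i <= Z)%N.
Proof. exact: leq_trans (ltnW (ltn_ord i)) nK_leZ. Qed.

Lemma evals_rank s il it F (i : 'I_(nK I)) :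
  nth (Nat 0) s il = enc_seq (map (enc_key F) (enum 'I_(nK I))) ->
  nth (Nat 0) s it = enc_key F i ->
  ev s (rank_exp il it) (Nat (rank (dist_key F) i)).
Proof.
move=> hl hi; rewrite /rank -sum1_count big_mkcond /=.
apply: (evals_sum (encT := enc_key F)) _ size_enum_term _ _; first exact: evals_var.
  apply: small; apply: leq_trans nK_leZ.
  rewrite -[leqRHS]size_enum_ord -sum1_size.
  by apply: leq_sum => j _; case: ifP.
move=> j x _; rewrite -[if _ then _ else _]/(nat_of_bool _) ltnNge.
apply: evals_not.
apply: (evals_op (m := tie_key (dist_key F) i) (n := tie_key (dist_key F) j)) => //.
- by ev_get.
- by apply: small3; rewrite ?dist_key_leZ ?term_leZ.
- by apply: small3; rewrite ?dist_key_leZ ?term_leZ.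
Qed.

Lemma evals_greedy s ic im F (leT : rel 'I_(nK I)) :
  (forall i j, leT i j = (dist_key F i <= dist_key F j)%N) ->
  nth (Nat 0) s ic = context -> nth (Nat 0) s im = Nat (mask F) ->
  ev s (greedy_exp ic im) (Nat (mask (foldl (add_pair_bits F) set0
    (sort leT (enum 'I_(nK I)))))).
Proof.
move=> leTE hc hm; rewrite -(foldl_sort leTE).
apply: (@evals_let _ _ _ _ (enc_seq (map (enc_key F) (enum 'I_(nK I))))).
  apply: (@evals_map _ _ enc_term) size_enum_term _ _; first by ev_get.
  move=> i acc _; apply: evals_let; first by ev_get.
  apply: evals_let; first by ev_get.
  do 3?[apply: evals_pair]; try exact: evals_cst; try exact: evals_var; try ev_get.
  apply: (evals_op (m := (dist_key F i * nK I)%N) (n := i)); try ev_get.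
  - apply: (evals_op (m := dist_key F i) (n := nK I)); try ev_get.
    + apply: (evals_op (m := cdist F (terminals i).1 (terminals i).2) (n := B)); try ev_get.
      * exact: (evals_dist (F := F)).
      * exact/small/cdist_leZ.
      * exact/small/B_leZ.
      * by [].
    + exact/small/dist_key_leZ.
    + exact: small.
    + by [].
  - by rewrite -[(_ * _)%N]addn0 small3 ?dist_key_leZ.
  - exact/small/term_leZ.
  - by [].
have encH0 : Nat 0 = Nat (mask (set0 : {set edge I})) by rewrite /mask big_set0.
apply: (evals_foldT (encT := enc_key F) (encX := fun H : {set edge I} => Nat (mask H)))
  _ size_enum_term _ _; first exact: evals_var.
  by rewrite -encH0; apply: evals_cst.
move=> i0 H0 _.
apply: (evals_foldT (encT := enc_key F) (encX := fun H : {set edge I} => Nat (mask H)))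
  _ size_enum_term _ _; try exact: evals_var.
move=> i H _; apply: (evals_if (t := rank (dist_key F) i == i0)).
- apply: evals_eq; [exact: evals_rank | by ev_get | | exact/small/term_leZ].
  apply: small; apply: leq_trans nK_leZ; rewrite -[leqRHS]size_enum_ord.
  exact: count_size.
- move=> ->; apply: evals_let; first by ev_get.
  by apply: evals_add_pair => //; rewrite addnC.
- by move/negbTE->; apply: evals_var.
Qed.

(** The fold prepends, so running over the reversed edge list produces the indices in increasing
    order. *)
Lemma evals_output s ic im (F : {set edge I}) :
  nth (Nat 0) s ic = context -> nth (Nat 0) s im = Nat (mask F) ->
  ev s (output_exp ic im) (enc_spanner (I := I) F).
Proof.
move=> hc hm; have s2 : (2 < 2 ^ M)%N by apply: small.
have -> : enc_spanner (I := I) F =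
    foldl (fun acc e => if e \in F then Pair (Nat e) acc else acc) (Nat 0) (rev (enum (edge I))).
  rewrite /enc_spanner foldl_rev {1}/enum_mem -enumT.
  by elim: (enum _) => //= e t <-; case: (e \in F).
apply: (evals_foldT (encT := enc_edge) (encX := id)).
- by apply: evals_rev size_enum_edge _; ev_get.
- by rewrite size_rev size_enum_edge.
- exact: evals_cst.
move=> e acc _; apply: (evals_if (t := e \in F)).
- rewrite -mask_testbit; apply: evals_bit => //; [exact: set_le | exact/small/pow_leZ].
- by move=> ->; apply: evals_pair; [ev_get | apply: evals_var].
- by move/negbTE->; apply: evals_var.
Qed.

End Subroutines.

(** * Preprocessing *)

(** The accumulator holds the list built so far, the next power of two and the next index; powers
    arise by doubling. *)
Definition number_exp (l : exp) : exp :=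
  rev_exp (Fst (Fold l (MkPair (Cst 0) (MkPair (Cst 1) (Cst 0)))
    (MkPair
       (MkPair (record [:: Fst (Snd (Var 1)); Snd (Snd (Var 1)); Var 0]) (Fst (Var 1)))
       (MkPair (Op Mul (Fst (Snd (Var 1))) (Cst 2))
               (Op Add (Snd (Snd (Var 1))) (Cst 1)))))).

Lemma evals_number M n (f : 'I_n -> data) s l : (n <= M)%N -> (1 < M)%N ->
  evals M s l (enc_seq (map f (enum 'I_n))) ->
  evals M s (number_exp l)
    (enc_seq [seq enc_seq [:: Nat (2 ^ i); Nat i; f i] | i : 'I_n <- enum 'I_n]).
Proof.
move=> nM M1 hl; set g := fun i : 'I_n => enc_seq [:: Nat (2 ^ i); Nat i; f i].
have sz : (size (enum 'I_n) <= M)%N by rewrite size_enum_ord.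
rewrite -[in X in evals _ _ _ X](revK (enum 'I_n)).
apply: evals_rev; first by rewrite size_rev.
pose enc k := Pair (enc_seq (map g (rev (take k (enum 'I_n))))) (Pair (Nat (2 ^ k)) (Nat k)).
apply: (@evals_fst _ _ _ _ (Pair (Nat (2 ^ n)) (Nat n))).
have -> : Pair (enc_seq (map g (rev (enum 'I_n)))) (Pair (Nat (2 ^ n)) (Nat n)) =
    enc (foldl (fun k _ => k.+1) 0 (enum 'I_n)).
  have -> : foldl (fun k (_ : 'I_n) => k.+1) 0 (enum 'I_n) = n.
    have h (t : seq 'I_n) k : foldl (fun k _ => k.+1) k t = (k + size t)%N.
      by elim: t k => [|i t IHt] k /=; rewrite ?addn0 // IHt addSnnS.
    by rewrite h size_enum_ord.
  by rewrite /enc take_oversize ?size_enum_ord.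
(* That the rest of the list is [drop k] identifies the current element as the one with index
   [k]. *)
apply: (evals_fold (encT := f) (encX := enc) (inv := fun r k => r = drop k (enum 'I_n)))
  hl sz _ _ _.
- by rewrite /enc take0; do 2?[apply: evals_pair]; apply: evals_cst.
- by rewrite drop0.
move=> i r k _ er; have kn : (k < n)%N.
  rewrite ltnNge; apply/negP=> nk; move: er.
  by rewrite drop_oversize ?size_enum_ord.
have [ei er'] : i = nth i (enum 'I_n) k /\ r = drop k.+1 (enum 'I_n).
  by move: er; rewrite (drop_nth i) ?size_enum_ord // => -[].
split=> //; have ik : i = k :> nat by rewrite ei nth_enum_ord.
have pM : (2 ^ k < 2 ^ M)%N by rewrite ltn_exp2l // (leq_trans kn).
have kM : (k < 2 ^ M)%N by apply: leq_trans pM; apply: leqW; apply: ltn_expl.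
have [M2 M1'] : (2 < 2 ^ M /\ 1 < 2 ^ M)%N.
  by split; [rewrite -[X in (X < _)%N]expn1 | rewrite -[X in (X < _)%N](expn0 2)];
    rewrite ltn_exp2l // ltnW.
have h1 : evals M [:: f i, enc k & s] (Fst (Snd (Var 1))) (Nat (2 ^ k)).
  by apply: evals_fst; apply: evals_snd; apply: evals_var.
have h2 : evals M [:: f i, enc k & s] (Snd (Snd (Var 1))) (Nat k).
  by apply: evals_snd; apply: evals_snd; apply: evals_var.
rewrite [enc k.+1]/enc (take_nth i) ?size_enum_ord // -ei rev_rcons /= {1}/g ik.
apply: evals_pair; [apply: evals_pair | apply: evals_pair].
- by do 3?[apply: evals_pair] => //; exact: evals_cst.
- by apply: evals_fst; apply: evals_var.
- by apply: (evals_op (m := (2 ^ k)%N) (n := 2)) => //=; rewrite expnSr.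
- by apply: (evals_op (m := k) (n := 1)) => //=; rewrite addn1.
Qed.

(** Polynomial bounds are closed under sums and under multiplication by [M], and arithmetic adds
    only a fixed square. Powers of [M + 2] are at least 1, so exponents can be raised to a common
    one. *)
Lemma time_bound_poly e : exists c k, forall M, (time_bound M e <= c * (M + 2) ^ k)%N.
Proof.
have le c k k' M : (k <= k')%N -> (c * (M + 2) ^ k <= c * (M + 2) ^ k')%N.
  by move=> kk; rewrite leq_mul2l leq_pexp2l ?orbT // addn2.
have pos M k : (1 <= (M + 2) ^ k)%N by rewrite expn_gt0 addn2.
have plus f g : (exists c k, forall M, (f M <= c * (M + 2) ^ k)%N) ->
    (exists c k, forall M, (g M <= c * (M + 2) ^ k)%N) ->
    (exists c k, forall M, (f M + g M <= c * (M + 2) ^ k)%N).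
  case=> c1 [k1 h1] [c2 [k2 h2]]; exists (c1 + c2)%N, (k1 + k2)%N => M.
  rewrite mulnDl leq_add // ?(leq_trans (h1 M)) ?(leq_trans (h2 M)) // le //.
    exact: leq_addr.
  exact: leq_addl.
have one n : exists c k, forall M, (n <= c * (M + 2) ^ k)%N.
  by exists n, 0%N => M; rewrite muln1.
have succ f : (exists c k, forall M, (f M <= c * (M + 2) ^ k)%N) ->
    (exists c k, forall M, ((f M).+1 <= c * (M + 2) ^ k)%N).
  move=> hf; have [c [k h]] := plus f (fun=> 1%N) hf (one 1%N).
  by exists c, k => M; rewrite -addn1.
have times f : (exists c k, forall M, (f M <= c * (M + 2) ^ k)%N) ->
    (exists c k, forall M, (M * f M <= c * (M + 2) ^ k)%N).
  case=> c [k h]; exists c, k.+1 => M.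
  by rewrite expnS mulnCA leq_mul // leq_addr.
elim: e => [i|n|a IHa b IHb|a IHa|a IHa|a IHa|o a IHa b IHb|c IHc a IHa b IHb|
  a IHa b IHb|l IHl a IHa b IHb] /=; auto.
apply: (plus (fun M => time_bound M a + time_bound M b)%N (fun M => M.+2 * M.+2)%N).
  exact: plus.
by exists 1%N, 2%N => M; rewrite mul1n addn2.
Qed.

Lemma foldl_prod (T : Type) (f : T -> nat) a (t : seq T) :
  (foldl (fun x i => x * f i) a t = a * \prod_(i <- t) f i)%N.
Proof.
elim: t a => [|i t IHt] a /=; first by rewrite big_nil muln1.
by rewrite IHt big_cons mulnA.
Qed.

Lemma data_size_enc_seq (T : Type) (f : T -> data) (t : seq T) :
  (data_size (enc_seq (map f t)) = (\sum_(i <- t) (data_size (f i)).+1).+1)%N.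
Proof.
elim: t => [|i t IHt] /=; first by rewrite big_nil.
by rewrite big_cons IHt addnS addSn.
Qed.

Lemma size_le_data_size (T : Type) (f : T -> data) (t : seq T) :
  (size t <= data_size (enc_seq (map f t)))%N.
Proof.
rewrite data_size_enc_seq -sum1_size; apply: leqW.
by apply: leq_sum => i _.
Qed.

Lemma mem_le_data_size (T : eqType) (f : T -> data) (t : seq T) i : i \in t ->
  (data_size (f i) <= data_size (enc_seq (map f t)))%N.
Proof.
move=> it; rewrite data_size_enc_seq (big_rem i) //=.
by apply: leqW; apply: leq_trans (leq_addr _ _); apply: leqW.
Qed.

Lemma lt_exp_bits n : (n < 2 ^ bits n)%N.
Proof. exact: trunc_log_ltn. Qed.

Section Preprocessing.
Variable I : instance.

Definition input_edge (e : edge I) : data :=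
  enc_seq [:: Nat (ends e).1; Nat (ends e).2; enc_rat (weight e); enc_rat (len e)].

Definition input_term (i : 'I_(nK I)) : data :=
  enc_seq [:: Nat (terminals i).1; Nat (terminals i).2; enc_rat (demand i)].

Lemma enc_instanceE : enc_instance I =
  enc_seq [:: Nat (directed I); Nat (nV I);
    enc_seq (map input_edge (enum (edge I)));
    enc_seq (map input_term (enum 'I_(nK I)))].
Proof. by []. Qed.

Definition edge_denominators (e : edge I) : nat :=
  (`|denq (weight e)| * `|denq (len e)|)%N.

Definition common_denominator : nat :=
  foldl (fun a i => a * `|denq (demand i)|)%N
    (foldl (fun a e => a * edge_denominators e)%N 1%N (enum (edge I)))
    (enum 'I_(nK I)).

Local Notation Q := common_denominator.

Definition scale (q : rat) : nat := (`|numq q| * (Q %/ `|denq q|))%N.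

Lemma denq_gt0N (q : rat) : (0 < `|denq q|)%N.
Proof. by rewrite absz_gt0 denq_neq0. Qed.

Lemma common_denominatorE : (Q = (\prod_e edge_denominators e) *
  \prod_(i : 'I_(nK I)) `|denq (demand i)|)%N.
Proof. by rewrite /Q !foldl_prod mul1n !big_enum. Qed.

Lemma common_denominator_gt0 : (0 < Q)%N.
Proof.
rewrite common_denominatorE muln_gt0 !prodn_gt0 // => [i|e]; first exact: denq_gt0N.
by rewrite muln_gt0 !denq_gt0N.
Qed.

Lemma scaleE (q : rat) : 0 <= q -> (`|denq q| %| Q)%N -> (scale q)%:R = q * Q%:R.
Proof.
move=> q0 dQ; rewrite /scale natrM.
rewrite -[in RHS](divnK dQ) natrM [_ * `|denq q|%:R]mulrC mulrA; congr (_ * _).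
by rewrite !natr_absz !ger0_norm ?numq_ge0 ?denq_ge0 // numqE.
Qed.

Lemma dvd_weight (e : edge I) : (`|denq (weight e)| %| Q)%N.
Proof.
rewrite common_denominatorE (bigD1 e) //= /edge_denominators.
by rewrite -!mulnA dvdn_mulr.
Qed.

Lemma dvd_len (e : edge I) : (`|denq (len e)| %| Q)%N.
Proof.
rewrite common_denominatorE (bigD1 e) //= /edge_denominators.
by rewrite -!mulnA dvdn_mull // dvdn_mulr.
Qed.

Lemma dvd_demand (i : 'I_(nK I)) : (`|denq (demand i)| %| Q)%N.
Proof. by rewrite common_denominatorE [X in (_ * X)%N](bigD1 i) //= dvdn_mull ?dvdn_mulr. Qed.

Definition Wn (e : edge I) := scale (weight e).
Definition Ln (e : edge I) := scale (len e).
Definition Dn (i : 'I_(nK I)) := scale (demand i).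

Lemma WnE (e : edge I) : (Wn e)%:R = weight e * Q%:R.
Proof. exact: scaleE (weight_ge0 e) (dvd_weight e). Qed.

Lemma LnE (e : edge I) : (Ln e)%:R = len e * Q%:R.
Proof. exact: scaleE (ltW (len_gt0 e)) (dvd_len e). Qed.

Lemma DnE (i : 'I_(nK I)) : (Dn i)%:R = demand i * Q%:R.
Proof. exact: scaleE (ltW (demand_gt0 i)) (dvd_demand i). Qed.

Local Notation S := (data_size (enc_instance I)).

Lemma input_edges_size : (data_size (enc_seq (map input_edge (enum (edge I)))) <= S)%N.
Proof. by rewrite enc_instanceE /=; lia. Qed.

Lemma input_terms_size : (data_size (enc_seq (map input_term (enum 'I_(nK I)))) <= S)%N.
Proof. by rewrite enc_instanceE /=; lia. Qed.

Lemma data_size_gt0 : (0 < S)%N. Proof. by rewrite enc_instanceE. Qed.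

Lemma nE_leS : (nE I <= S)%N.
Proof.
apply: leq_trans input_edges_size; rewrite -[X in (X <= _)%N](size_enum_ord (nE I)).
exact: size_le_data_size.
Qed.

Lemma nK_leS : (nK I <= S)%N.
Proof.
apply: leq_trans input_terms_size; rewrite -[X in (X <= _)%N](size_enum_ord (nK I)).
exact: size_le_data_size.
Qed.

Lemma edge_leS (e : edge I) : (data_size (input_edge e) <= S)%N.
Proof.
by apply: leq_trans input_edges_size; apply: mem_le_data_size; rewrite mem_enum.
Qed.

Lemma term_leS (i : 'I_(nK I)) : (data_size (input_term i) <= S)%N.
Proof.
by apply: leq_trans input_terms_size; apply: mem_le_data_size; rewrite mem_enum.
Qed.

Lemma lt_expS n : (bits n <= S)%N -> (n < 2 ^ S)%N.
Proof. by move=> h; apply: leq_trans (lt_exp_bits n) _; rewrite leq_exp2l. Qed.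

Lemma nV_lt : (nV I < 2 ^ S)%N.
Proof. by apply: lt_expS; rewrite enc_instanceE /=; lia. Qed.

Lemma numbers_lt (q : rat) : (data_size (enc_rat q) <= S)%N ->
  (`|numq q| < 2 ^ S)%N /\ (`|denq q| < 2 ^ S)%N.
Proof. by move=> h; split; apply: lt_expS; move: h => /=; lia. Qed.

Lemma weight_lt (e : edge I) :
  (`|numq (weight e)| < 2 ^ S)%N /\ (`|denq (weight e)| < 2 ^ S)%N.
Proof. by apply: numbers_lt; apply: leq_trans (edge_leS e) => /=; lia. Qed.

Lemma len_lt (e : edge I) :
  (`|numq (len e)| < 2 ^ S)%N /\ (`|denq (len e)| < 2 ^ S)%N.
Proof. by apply: numbers_lt; apply: leq_trans (edge_leS e) => /=; lia. Qed.

Lemma demand_lt (i : 'I_(nK I)) :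
  (`|numq (demand i)| < 2 ^ S)%N /\ (`|denq (demand i)| < 2 ^ S)%N.
Proof. by apply: numbers_lt; apply: leq_trans (term_leS i) => /=; lia. Qed.

Lemma prod_le_exp (n a : nat) (f : 'I_n -> nat) : (n <= S)%N ->
  (forall i, f i <= 2 ^ a)%N -> (\prod_i f i <= 2 ^ (a * S))%N.
Proof.
move=> nS fa; apply: (@leq_trans (\prod_(i : 'I_n) 2 ^ a)).
  by apply: leq_prod => i _.
by rewrite prod_nat_const card_ord -expnM leq_exp2l // leq_mul2l nS orbT.
Qed.

(** At most [S] edges contribute two denominators of at most [S] bits each, and at most [S] pairs
    contribute one. *)
Lemma common_denominator_le : (Q <= 2 ^ (3 * S * S))%N.
Proof.
rewrite common_denominatorE.
have -> : (3 * S * S = (2 * S) * S + S * S)%N by lia.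
rewrite expnD leq_mul //; apply: prod_le_exp; rewrite ?nE_leS ?nK_leS //.
  move=> e; rewrite /edge_denominators mul2n -addnn expnD.
  by rewrite leq_mul // ltnW //; [case: (weight_lt e) | case: (len_lt e)].
by move=> i; apply: ltnW; case: (demand_lt i).
Qed.

Lemma scale_le (q : rat) : (`|numq q| < 2 ^ S)%N -> (scale q <= 2 ^ (4 * S * S))%N.
Proof.
move=> h; apply: (@leq_trans (2 ^ S * 2 ^ (3 * S * S))).
  rewrite leq_mul ?(ltnW h) //; apply: leq_trans (leq_div _ _) common_denominator_le.
by rewrite -expnD leq_exp2l //; have := data_size_gt0; nia.
Qed.

Lemma sum_le_exp (n : nat) (f : 'I_n -> nat) : (n <= S)%N ->
  (forall i, f i <= 2 ^ (4 * S * S))%N -> (\sum_i f i <= 2 ^ (5 * S * S))%N.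
Proof.
move=> nS fa; apply: (@leq_trans (\sum_(i : 'I_n) 2 ^ (4 * S * S))).
  by apply: leq_sum => i _.
rewrite sum_nat_const card_ord; apply: (@leq_trans (2 ^ S * 2 ^ (4 * S * S))).
  by rewrite leq_mul2r (leq_trans nS) ?orbT // ltnW // ltn_expl.
by rewrite -expnD leq_exp2l //; have := data_size_gt0; nia.
Qed.

Lemma sum_Wn_le : (\sum_e Wn e <= 2 ^ (5 * S * S))%N.
Proof.
by apply: (sum_le_exp nE_leS) => e; apply: scale_le; case: (weight_lt e).
Qed.

(** [B] is at most [2 ^ S], and the two sums plus 1 are at most four times [2 ^ (5 * S * S)]. The
    exponent [S + 5 * S * S + 2] is at most [8 * S * S] because [S] is positive. *)
Lemma inf_le : (inf Ln Dn <= 2 ^ (8 * S * S))%N.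
Proof.
have hL : (\sum_e Ln e <= 2 ^ (5 * S * S))%N.
  by apply: (sum_le_exp nE_leS) => e; apply: scale_le; case: (len_lt e).
have hD : (\sum_i Dn i <= 2 ^ (5 * S * S))%N.
  by apply: (sum_le_exp nK_leS) => i; apply: scale_le; case: (demand_lt i).
apply: (@leq_trans (2 ^ S * 2 ^ (5 * S * S + 2))).
  rewrite /inf leq_mul ?leq_exp2l ?nE_leS // expnD.
  have h1 : (1 <= 2 ^ (5 * S * S))%N by rewrite expn_gt0.
  apply: leq_trans (leq_add (leq_add hL hD) h1) _.
  by lia.
by rewrite -expnD leq_exp2l //; have := data_size_gt0; nia.
Qed.

End Preprocessing.

Definition scale_exp (iq k i : nat) : exp :=
  Op Mul (Fst (get k i)) (Op Div (Var iq) (Snd (get k i))).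

(* The environment of the program consists of the input only. *)
Definition context_exp : exp :=
  Let (Fold (get 3 0)
        (Fold (get 2 0) (Cst 1)
          (Op Mul (Var 1) (Op Mul (Snd (get 2 0)) (Snd (get 3 0)))))
        (Op Mul (Var 1) (Snd (get 2 0))))
  (* den :: input *)
  (Let (map_exp (number_exp (get 2 1))
    (Let (get 2 0)
    (* e :: numbered e :: acc :: den :: input *)
    (record [:: get 0 0; get 1 0; scale_exp 3 2 0; scale_exp 3 3 0; get 0 1; get 1 1])))
  (* edges :: den :: input *)
  (Let (map_exp (number_exp (get 3 2))
    (Let (get 2 0)
    (* i :: numbered i :: acc :: edges :: den :: input *)
    (record [:: get 0 0; get 1 0; scale_exp 4 2 0; get 1 1])))
  (* terms :: edges :: den :: input *)
  (Let (Fold (Var 1) (Cst 1) (Op Mul (Var 1) (Cst 2)))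
  (Let (Fold (Var 1) (Cst 0) (Op Add (Var 1) (Cst 1)))
  (* nK :: 2 ^ nE :: terms :: edges :: den :: input *)
  (Let (Fold (Var 3) (Cst 0) (Op Add (Var 1) (get 3 0)))
  (Let (Fold (Var 3) (Cst 0) (Op Add (Var 1) (get 2 0)))
  (* sums :: nK :: 2 ^ nE :: terms :: edges :: den :: input *)
  (record [:: Op Mul (Var 3) (Op Add (Op Add (Var 1) (Var 0)) (Cst 1));
     Var 3; get 0 7; Var 5; Var 4; Var 2]))))))).

Definition weight_bound_exp (mst : bool) : exp :=
  if mst then
    Let (threshold_exp 0) (Let (mst_exp 1) (If (Op Leq (Var 1) (Var 0)) (Var 0) (Var 1)))
  else threshold_exp 0.

Definition augmented_greedy_exp (mst : bool) : exp :=
  Let context_exp (Let (weight_bound_exp mst) (Let (light_exp 1 0)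
  (Let (greedy_exp 2 0) (output_exp 3 0)))).

(** * Correctness and word size of the whole program *)

Section Program.
Variable I : instance.
Local Notation S := (data_size (enc_instance I)).

(** All stored values are at most [Z], and [Z * Z + Z] is at most [2 ^ (16 * S * S + 1)], whence the
    factor 17. *)
Definition word_size : nat := (17 * S * S)%N.
Local Notation M := word_size.
Local Notation Z := (2 ^ (8 * S * S))%N.
Local Notation ev := (evals M).
Local Notation Q := (common_denominator I).

Let S0 : (0 < S)%N := data_size_gt0 I.

Lemma Z_gt1 : (1 < Z)%N.
Proof. by rewrite -[X in (X < _)%N](expn0 2) ltn_exp2l // !muln_gt0 S0. Qed.

Lemma ZM : (Z * Z + Z < 2 ^ M)%N.
Proof.
apply: (@leq_trans (2 ^ (16 * S * S + 1))).
  have -> : (16 * S * S + 1 = 8 * S * S + 8 * S * S + 1)%N by lia.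
  by rewrite !expnD; have := Z_gt1; nia.
by rewrite leq_exp2l // /word_size; nia.
Qed.

Lemma leS_leZ a n : (a <= 2 ^ n)%N -> (n <= 8 * S * S)%N -> (a <= Z)%N.
Proof. by move=> h1 h2; apply: leq_trans h1 _; rewrite leq_exp2l. Qed.

Lemma leZ_ltM a : (a <= Z)%N -> (a < 2 ^ M)%N.
Proof. by move=> h; have := ZM; lia. Qed.

Lemma W_leZ : (\sum_(e : edge I) Wn e <= Z)%N.
Proof. by apply: leS_leZ (sum_Wn_le I) _; nia. Qed.

Lemma inf_leZ : (inf (@Ln I) (@Dn I) <= Z)%N.
Proof. exact: inf_le. Qed.

Lemma lt_expS_leZ a : (a < 2 ^ S)%N -> (a <= Z)%N.
Proof. by move=> /ltnW h; apply: leS_leZ h _; nia. Qed.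

Lemma nV_leZ : (nV I <= Z)%N. Proof. exact/lt_expS_leZ/nV_lt. Qed.

Lemma nK_leZ : (nK I <= Z)%N.
Proof. exact/lt_expS_leZ/(leq_ltn_trans (nK_leS I))/ltn_expl. Qed.

Lemma nE_leM : (nE I <= M)%N.
Proof. by apply: leq_trans (nE_leS I) _; rewrite /word_size; nia. Qed.

Lemma nK_leM : (nK I <= M)%N.
Proof. by apply: leq_trans (nK_leS I) _; rewrite /word_size; nia. Qed.

Lemma M_gt1 : (1 < M)%N.
Proof. by rewrite /word_size; nia. Qed.

Lemma Q_leZ : (Q <= Z)%N.
Proof. by apply: leS_leZ (common_denominator_le I) _; nia. Qed.

Local Notation ctx := (context (@Wn I) (@Ln I) (@Dn I)).

Lemma evals_scale s iq k i (r : seq data) (q : rat) :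
  nth (Nat 0) s iq = Nat Q -> nth (Nat 0) s i = enc_seq r -> (k < size r)%N ->
  nth (Nat 0) r k = enc_rat q -> (`|numq q| < 2 ^ S)%N -> (`|denq q| < 2 ^ S)%N ->
  ev s (scale_exp iq k i) (Nat (scale I q)).
Proof.
move=> hQ hi kr hq ltn ltd; have hg := evals_get M hi kr hq.
apply: (evals_op (m := `|numq q|%N) (n := (Q %/ `|denq q|)%N)).
- exact: evals_fst hg.
- apply: evals_op; [exact: evals_var hQ | exact: evals_snd hg | | | reflexivity].
    exact/leZ_ltM/Q_leZ.
  exact/leZ_ltM/lt_expS_leZ.
- exact/leZ_ltM/lt_expS_leZ.
- exact/leZ_ltM/(leq_trans (leq_div _ _))/Q_leZ.
- by [].
Qed.

Lemma foldl_count (T : Type) (t : seq T) k : foldl (fun k _ => k + 1)%N k t = (k + size t)%N.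
Proof. by elim: t k => [|i t IHt] k /=; rewrite ?addn0 // IHt -addnA add1n. Qed.

Lemma foldl_double (T : Type) (t : seq T) k :
  foldl (fun k _ => k * 2)%N k t = (k * 2 ^ size t)%N.
Proof. by elim: t k => [|i t IHt] k /=; rewrite ?muln1 // IHt -mulnA expnS. Qed.

Lemma evals_context : ev [:: enc_instance I] context_exp ctx.
Proof.
have szE := size_enum_edge nE_leM; have szK := size_enum_term nK_leM.
have ltZ := leZ_ltM; have Z1 := Z_gt1.
have sumE : (\sum_(e : edge I) Ln e + \sum_(i < nK I) Dn i + 1 <= inf (@Ln I) (@Dn I))%N.
  by rewrite /inf leq_pmull // expn_gt0.
have h1 : (\sum_(e : edge I) Ln e + \sum_(i < nK I) Dn i + 1 <= Z)%N.
  exact: leq_trans sumE inf_leZ.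
have h2 : (\sum_(e : edge I) Ln e + \sum_(i < nK I) Dn i <= Z)%N.
  exact: leq_trans (leq_addr _ _) h1.
have h3 : (\sum_(e : edge I) Ln e <= Z)%N by apply: leq_trans (leq_addr _ _) h2.
have h4 : (\sum_(i < nK I) Dn i <= Z)%N by apply: leq_trans (leq_addl _ _) h2.
apply: (@evals_let _ _ _ _ (Nat Q)).
  apply: (evals_fold_incr (encT := @input_term I)) _ szK _ _ _ _.
  - by ev_get.
  - apply: (evals_fold_incr (encT := @input_edge I)) _ szE _ _ _ _.
    + by ev_get.
    + exact: evals_cst.
    (* The product over the edges is a factor of the common denominator, and the cofactor is
       positive. *)
    + apply/ltZ/(leq_trans _ Q_leZ); rewrite /common_denominator.
      by rewrite foldl_prod leq_pmulr // big_enum prodn_gt0 // => i; apply: denq_gt0N.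
    + by move=> e x _; rewrite leq_pmulr // muln_gt0 !denq_gt0N.
    + move=> e x _ xM eM; apply: (evals_op (m := x) (n := edge_denominators e)) => //.
      * apply: (evals_op (m := `|denq (weight e)|%N) (n := `|denq (len e)|%N)) => //.
          by apply/ltZ/lt_expS_leZ; case: (weight_lt e).
        by apply/ltZ/lt_expS_leZ; case: (len_lt e).
      * apply: ltZ; apply: (@leS_leZ _ (S + S)); last by nia.
        by rewrite expnD leq_mul // ltnW //; [case: (weight_lt e) | case: (len_lt e)].
  - exact/ltZ/Q_leZ.
  - by move=> i x _; rewrite leq_pmulr // denq_gt0N.
  - move=> i x _ xM iM; apply: (evals_op (m := x) (n := `|denq (demand i)|%N)) => //.
    by apply/ltZ/lt_expS_leZ; case: (demand_lt i).
apply: (@evals_let _ _ _ _ (enc_seq (map (enc_edge (@Wn I) (@Ln I)) (enum (edge I))))).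
  apply: evals_map szE _ _.
    by apply: (evals_number (f := @input_edge I) nE_leM M_gt1); ev_get.
  move=> e acc _; apply: evals_let; first by ev_get.
  do 6?[apply: evals_pair]; try exact: evals_cst; try ev_get.
  - by apply: (evals_scale (q := weight e)) => //; case: (weight_lt e).
  - by apply: (evals_scale (q := len e)) => //; case: (len_lt e).
apply: (@evals_let _ _ _ _ (enc_seq (map (enc_term (@Dn I)) (enum 'I_(nK I))))).
  apply: evals_map szK _ _.
    by apply: (evals_number (f := @input_term I) nK_leM M_gt1); ev_get.
  move=> i acc _; apply: evals_let; first by ev_get.
  do 4?[apply: evals_pair]; try exact: evals_cst; try ev_get.
  by apply: (evals_scale (q := demand i)) => //; case: (demand_lt i).
have BM : (2 ^ nE I < 2 ^ M)%N by apply/ltZ/(B_leZ inf_leZ).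
apply: (@evals_let _ _ _ _ (Nat (2 ^ nE I))).
  have -> : (2 ^ nE I = foldl (fun k _ => k * 2) 1 (enum (edge I)))%N.
    by rewrite foldl_double mul1n size_enum_ord.
  apply: (evals_fold_incr (encT := enc_edge (@Wn I) (@Ln I))) _ szE _ _ _ _.
  - exact: evals_var.
  - exact: evals_cst.
  - by rewrite foldl_double mul1n size_enum_ord.
  - by move=> e x _; rewrite leq_pmulr.
  - by move=> e x _ xM _; apply: (evals_op (m := x) (n := 2)) => //; apply: ltZ.
apply: (@evals_let _ _ _ _ (Nat (nK I))).
  have e : nK I = foldl (fun k _ => k + 1)%N 0%N (enum 'I_(nK I)).
    by rewrite foldl_count size_enum_ord.
  rewrite [X in ev _ _ X](congr1 Nat e) {e}.
  apply: (evals_fold_incr (encT := enc_term (@Dn I))) _ szK _ _ _ _.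
  - exact: evals_var.
  - exact: evals_cst.
  - by rewrite foldl_count size_enum_ord; apply/ltZ/nK_leZ.
  - by move=> e x _; rewrite leq_addr.
  - by move=> e x _ xM _; apply: (evals_op (m := x) (n := 1)) => //; apply/ltZ/ltnW.
apply: (@evals_let _ _ _ _ (Nat (\sum_(e : edge I) Ln e)%N)).
  rewrite -big_enum; apply: (evals_sum (encT := enc_edge (@Wn I) (@Ln I))) _ szE _ _.
  - exact: evals_var.
  - by rewrite big_enum /=; apply: ltZ.
  - by move=> e x _; ev_get.
apply: (@evals_let _ _ _ _ (Nat (\sum_(i <- enum 'I_(nK I)) Dn i)%N)).
  apply: (evals_sum (encT := enc_term (@Dn I))) _ szK _ _.
  - exact: evals_var.
  - by rewrite big_enum /=; apply: ltZ.
  - by move=> e x _; ev_get.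
rewrite big_enum /=.
do 6?[apply: evals_pair]; try exact: evals_cst; try exact: evals_var; try ev_get.
apply: (evals_op (m := (2 ^ nE I)%N)
  (n := (\sum_(e : edge I) Ln e + \sum_(i < nK I) Dn i + 1)%N)).
- exact: evals_var.
- apply: (evals_op (m := (\sum_(e : edge I) Ln e + \sum_(i < nK I) Dn i)%N) (n := 1%N)).
  + apply: (evals_op (m := (\sum_(e : edge I) Ln e)%N) (n := (\sum_(i < nK I) Dn i)%N)).
    * exact: evals_var.
    * exact: evals_var.
    * by apply: ltZ => //; apply: ltnW.
    * by apply: ltZ => //; apply: ltnW.
    * by [].
  + exact: evals_cst.
  + by apply: ltZ => //; apply: ltnW.
  + by apply: ltZ => //; apply: ltnW.
  + by [].
- by [].
- by apply: ltZ => //; apply: ltnW.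
- by [].
Qed.

Hypothesis has_feasible : exists F : {set edge I}, feasible F.

Let Q0 : (0 < Q)%N := common_denominator_gt0 I.

Lemma evals_threshold_nat s ic : nth (Nat 0) s ic = ctx ->
  ev s (threshold_exp ic) (Nat (threshold_nat (@Wn I))).
Proof.
move=> hc; have -> : threshold_nat (@Wn I) = fold_min
    (fun e => if [forall i, sat (@Ln I) (@Dn I) (light (@Wn I) (Wn e)) i]
              then Wn e else \sum_(e : edge I) Wn e)%N
    (\sum_(e : edge I) Wn e)%N (enum (edge I)).
  rewrite /threshold_nat /fold_min; elim: (enum _) {2 4}(\sum_e _)%N => //= e t IHt a.
  by rewrite -(feasibleE Q0 (@LnE I) (@DnE I)) IHt.
by apply: (evals_threshold Z_gt1 ZM inf_leZ W_leZ nV_leZ nE_leM nK_leM).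
Qed.

Lemma threshold_nat_leZ : (threshold_nat (@Wn I) <= Z)%N.
Proof. exact: leq_trans (fold_min_le _ _ _) W_leZ. Qed.

Lemma mst_nat_leZ : (mst_nat (@Wn I) (@Ln I) (@Dn I) <= Z)%N.
Proof. by apply: leq_trans W_leZ; apply: leq_sum => e _; case: ifP. Qed.

Definition weight_bound (mst : bool) : nat :=
  if mst then maxn (threshold_nat (@Wn I)) (mst_nat (@Wn I) (@Ln I) (@Dn I))
  else threshold_nat (@Wn I).

Lemma weight_bound_leZ mst : (weight_bound mst <= Z)%N.
Proof.
by case: mst; rewrite /weight_bound ?geq_max ?threshold_nat_leZ ?mst_nat_leZ.
Qed.

Lemma evals_weight_bound mst s :
  ev (ctx :: s) (weight_bound_exp mst) (Nat (weight_bound mst)).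
Proof.
case: mst; last exact: evals_threshold_nat.
apply: evals_let; first exact: evals_threshold_nat.
apply: evals_let.
  exact: (evals_mst Z_gt1 ZM inf_leZ W_leZ nV_leZ nE_leM).
rewrite /weight_bound.
set t := threshold_nat _; set m := mst_nat _ _ _; apply: (evals_if (t := (t <= m)%N)).
- apply: (evals_op (m := t) (n := m)); try exact: evals_var; last by [].
    exact/leZ_ltM/threshold_nat_leZ.
  exact/leZ_ltM/mst_nat_leZ.
- by move=> /maxn_idPr->; apply: evals_var.
- by rewrite -ltnNge => /ltnW/maxn_idPl->; apply: evals_var.
Qed.

(** The condition on [mst] is that of [mst_natE], where finite distances have to express
    connectedness. Scaling by the positive [Q] commutes with the maximum. *)
Lemma light_weight_bound (mst : bool) : (mst -> ~~ directed I) ->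
  light (@Wn I) (weight_bound mst) =
  light_edges I (if mst then Num.max (threshold I) (MST_weight I) else threshold I).
Proof.
have tE := threshold_natE Q0 (@WnE I) has_feasible.
have Q0' : 0 <= Q%:R :> rat by rewrite ler0n.
case: mst => [/(_ isT) und|_]; apply/esym; apply: (lightE Q0 (@WnE I)) => //.
rewrite /weight_bound maxr_pMl // -tE -(mst_natE (@Dn I) Q0 (@WnE I) (@LnE I) und).
by rewrite -natr_max maxEnat.
Qed.

Lemma foldl_add_pair_bits F (H : {set edge I}) (t : seq 'I_(nK I)) :
  foldl (add_pair F) H t = foldl (add_pair_bits (@Ln I) (@Dn I) F) H t.
Proof.
by elim: t H => //= i t IHt H; rewrite (add_pairE Q0 (@LnE I) (@DnE I)) IHt.
Qed.

Lemma evals_augmented_greedy (mst : bool) : (mst -> ~~ directed I) ->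
  ev [:: enc_instance I] (augmented_greedy_exp mst)
    (enc_spanner (augmented_greedy I mst)).
Proof.
move=> und; apply: evals_let; first exact: evals_context.
apply: evals_let; first exact: evals_weight_bound.
apply: evals_let.
  by apply: (evals_light (Ln := @Ln I) (Dn := @Dn I) Z_gt1 ZM W_leZ nE_leM
    (weight_bound_leZ mst)).
rewrite (light_weight_bound und) /augmented_greedy.
set F := light_edges I _; rewrite greedyE foldl_add_pair_bits.
apply: evals_let.
  apply: (evals_greedy Z_gt1 ZM inf_leZ nV_leZ nK_leZ nE_leM nK_leM
    (leT := fun i j => (tdist F i <= tdist F j)%E) (F := F)) => //.
  by move=> i j; rewrite (tdist_le (@Dn I) Q0 (@LnE I)).
by apply: (evals_output (Wn := @Wn I) (Ln := @Ln I) (Dn := @Dn I) Z_gt1 ZM inf_leZ nE_leM).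
Qed.

End Program.

(** * Polynomial time and the approximation guarantee *)

Lemma augmented_greedy_polynomial (mst : bool) (dom : instance -> Prop) :
  (forall I : instance, dom I ->
     (exists F : {set edge I}, feasible F) /\ (mst -> ~~ directed I)) ->
  polynomial_time dom (fun I => augmented_greedy I mst).
Proof.
move=> hdom; have [c [k hk]] := time_bound_poly (augmented_greedy_exp mst).
(* With [S] the input length, [17 * S * S + 2] is at most [19 * S * S]: this gives the factor
   [19 ^ k] and doubles the exponent. *)
exists (augmented_greedy_exp mst), (c * 19 ^ k)%N, (2 * k)%N => I /hdom[fI und].
have [e1 e2] := evals_augmented_greedy fI und; split=> //.
apply: leq_trans e2 (leq_trans (hk _) _); apply: leq_trans (leq_addr _ _).
rewrite -mulnA leq_mul2l; apply/orP; right.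
rewrite expnM -expnMn; case: k {hk} => // k; rewrite leq_exp2r // /word_size.
by have := data_size_gt0 I; nia.
Qed.

(** When the optional step is taken, the guarantee for the variant serves twice: connectedness of
    feasible spanners makes the spanning tree weight a lower bound on the optimum, and
    undirectedness makes the program compute this weight. *)
Theorem theorem3 (variant : instance -> Prop) (mst : bool)
    (hmst : mst -> guarantees_connected variant) :
  polynomial_time
    (fun I => variant I /\ exists F : {set edge I}, feasible F)
    (fun I => augmented_greedy I mst) /\
  (forall I : instance, variant I -> (exists F : {set edge I}, feasible F) ->
     feasible (augmented_greedy I mst) /\
     total_weight (augmented_greedy I mst) <= (nE I)%:R * OPT I).
Proof.
split.
  apply: augmented_greedy_polynomial => I [vI fI]; split=> // /hmst/(_ I vI)[].
  by [].
move=> I vI fI; rewrite /augmented_greedy; split.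
  apply: greedy_light_feasible => //; case: (mst) => //.
  by rewrite le_max lexx.
have [F fF <-] := OPT_attained fI.
apply: greedy_light_weight => // F0; case: (mst) hmst => [h|_]; last first.
  exact: threshold_le_weight.
rewrite ge_max threshold_le_weight //=.
have [_ /(_ F fF) cF] := h isT I vI.
exact: MST_weight_le_connected.
Qed.
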